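(* Let $\Lambda\in\{-1,0,1\}$. A lightlike tetrahedron in $\mathbb X_\Lambda$ is determined up to isometries by its edge lengths: two lightlike tetrahedra in $\mathbb X_\Lambda$ with the same edge lengths are isometric. If $L$ is a lightlike tetrahedron with vertices $$x_1=\begin{pmatrix}e^{\ell\alpha}&-2\ell s_\Lambda(\alpha)\\0&e^{-\ell\alpha}\end{pmatrix},\quad x_2=\begin{pmatrix}e^{\ell\beta}&0\\2\ell s_\Lambda(\beta)&e^{-\ell\beta}\end{pmatrix},\quad x_3=\begin{pmatrix}e^{-\ell\gamma}&0\\0&e^{\ell\gamma}\end{pmatrix},\quad x_4=\begin{pmatrix}1&0\\0&1\end{pmatrix},$$ where $\alpha,\beta>0$, $\gamma=-(\alpha+\beta)$, and $\alpha+\beta<\pi$ if $\Lambda=1$, then its edge lengths are $\alpha$, $\beta$ and $\alpha+\beta$, with opposite edges having equal lengths.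
   Context: $\mathbb C_\Lambda=\mathbb R[\ell]/(\ell^2+\Lambda)$, with $\overline{x+\ell y}=x-\ell y$, $|z|^2=z\overline z$; $e^{\ell\theta}=c_\Lambda(\theta)+\ell s_\Lambda(\theta)$, so $s_\Lambda=\sinh,\ \theta\mapsto\theta,\ \sin$ for $\Lambda=-1,0,1$. Put $\begin{pmatrix}a&b\\c&d\end{pmatrix}^\circ=\begin{pmatrix}\overline d&-\overline b\\-\overline c&\overline a\end{pmatrix}$. $\mathbb X_\Lambda=\{x\in\mathrm{Mat}(2,\mathbb C_\Lambda):x^\circ=x,\ \det x>0\}/\mathbb R^\times$ (3d anti-de Sitter, Minkowski, de Sitter space for $\Lambda=-1,0,1$); matrices denote the points they represent. $\mathrm{PGL}^+(2,\mathbb C_\Lambda)=\{A:|\det A|^2>0\}/\mathbb C_\Lambda^\times$ acts by $A\rhd x=AxA^\circ$; isometries of $\mathbb X_\Lambda$ are the elements of the group generated by this action and entrywise conjugation. Geodesics are the curves $t\mapsto A\rhd\exp(tX)$ with $X\in\mathfrak x_\Lambda=\{X:X^\circ=X,\mathrm{tr}X=0\}=\ell\,\mathfrak{sl}(2,\mathbb R)$; with $\langle X,X\rangle=-\det(\mathrm{Im}X)$ they are timelike, lightlike, spacelike if this is negative, zero, positive, and $t$ is the arc length parameter if $|\langle X,X\rangle|=1$. Geodesic planes are intersections of $\mathbb X_\Lambda$ with projective planes of the projectivization of $\{x=x^\circ\}\cong\mathbb R^4$; a plane is lightlike if it contains a lightlike but no timelike geodesic. A lightlike tetrahedron is a non-degenerate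 convex geodesic 3-simplex in $\mathbb X_\Lambda$ (the image of a cone $\{\sum_{i=1}^4a_ix_i':a_i\ge0,\sum a_i\neq0\}$ spanned by four linearly independent vectors, all of whose elements represent points of $\mathbb X_\Lambda$) whose faces lie in lightlike planes and such that all geodesics starting at a vertex and intersecting its interior are spacelike. The edge lengths are the arc lengths of its six (spacelike) edges, each edge being the image of the subcone spanned by two of the $x_i'$.
   Formalization: In the second part L is the simplex whose cone is spanned by the displayed matrices themselves, not any lightlike tetrahedron with these four points as vertices; for Λ=1 other sign choices give lightlike tetrahedra with lengths such as α, π−α−β, π−β. Constant geodesics (X=0) are excluded. *)

(* Defs.v *)
From HB Require Import structures.
From mathcomp Require Import all_boot all_order all_algebra.
From mathcomp Require Import all_classical all_reals all_analysis.
From mathcomp Require Import ring.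
Set Implicit Arguments.
Unset Strict Implicit.
Unset Printing Implicit Defensive.
Import Order.TTheory GRing.Theory Num.Theory.
Import numFieldNormedType.Exports.
Local Open Scope classical_set_scope.
Local Open Scope ring_scope.

(** ** The ring C_Lam = R[l]/(l^2 + Lam) *)

(* [GCplx Lam x y] is x + l y; the curvature Lam only enters multiplication. *)
Record gcplx (R : realType) (Lam : int) : Type :=
  GCplx { gre : R; gim : R }.
Arguments GCplx {R} Lam gre gim.

Definition gcplx_to_pair (R : realType) (Lam : int) (z : gcplx R Lam) : R * R :=
  (gre z, gim z).
Definition gcplx_of_pair (R : realType) (Lam : int) (p : R * R) : gcplx R Lam :=
  GCplx Lam p.1 p.2.

Lemma gcplx_to_pairK (R : realType) (Lam : int) :
  cancel (@gcplx_to_pair R Lam) (@gcplx_of_pair R Lam).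
Proof. by case. Qed.

HB.instance Definition _ (R : realType) (Lam : int) :=
  Choice.copy (gcplx R Lam) (can_type (@gcplx_to_pairK R Lam)).

Definition gadd (R : realType) (Lam : int) (z w : gcplx R Lam) : gcplx R Lam :=
  GCplx Lam (gre z + gre w) (gim z + gim w).
Definition gopp (R : realType) (Lam : int) (z : gcplx R Lam) : gcplx R Lam :=
  GCplx Lam (- gre z) (- gim z).
Definition gmul (R : realType) (Lam : int) (z w : gcplx R Lam) : gcplx R Lam :=
  GCplx Lam (gre z * gre w - Lam%:~R * (gim z * gim w))
            (gre z * gim w + gim z * gre w).

Lemma gaddA (R : realType) (Lam : int) : associative (@gadd R Lam).
Proof. by move=> [a b] [c d] [e f]; rewrite /gadd /= !addrA. Qed.
Lemma gaddC (R : realType) (Lam : int) : commutative (@gadd R Lam).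
Proof. by move=> [a b] [c d]; congr GCplx => /=; rewrite addrC. Qed.
Lemma gadd0 (R : realType) (Lam : int) :
  left_id (GCplx Lam 0 0) (@gadd R Lam).
Proof. by move=> [a b]; rewrite /gadd /= !add0r. Qed.
Lemma gaddN (R : realType) (Lam : int) :
  left_inverse (GCplx Lam 0 0) (@gopp R Lam) (@gadd R Lam).
Proof. by move=> [a b]; rewrite /gadd /= !addNr. Qed.

HB.instance Definition _ (R : realType) (Lam : int) :=
  GRing.isZmodule.Build (gcplx R Lam)
    (@gaddA R Lam) (@gaddC R Lam) (@gadd0 R Lam) (@gaddN R Lam).

Lemma gmulA (R : realType) (Lam : int) : associative (@gmul R Lam).
Proof. by move=> [a b] [c d] [e f]; congr GCplx => /=; ring. Qed.
Lemma gmulC (R : realType) (Lam : int) : commutative (@gmul R Lam).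
Proof. by move=> [a b] [c d]; congr GCplx => /=; ring. Qed.
Lemma gmul1 (R : realType) (Lam : int) :
  left_id (GCplx Lam 1 0) (@gmul R Lam).
Proof. by move=> [a b]; congr GCplx => /=; ring. Qed.
Lemma gmulDl (R : realType) (Lam : int) :
  left_distributive (@gmul R Lam) (@gadd R Lam).
Proof. by move=> [a b] [c d] [e f]; congr GCplx => /=; ring. Qed.
Lemma gone_neq0 (R : realType) (Lam : int) :
  GCplx Lam 1 0 != 0 :> gcplx R Lam.
Proof. by apply/eqP => -[] /eqP; rewrite oner_eq0. Qed.

HB.instance Definition _ (R : realType) (Lam : int) :=
  GRing.Zmodule_isComNzRing.Build (gcplx R Lam)
    (@gmulA R Lam) (@gmulC R Lam) (@gmul1 R Lam) (@gmulDl R Lam)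
    (@gone_neq0 R Lam).

Definition greal (R : realType) (Lam : int) (a : R) : gcplx R Lam :=
  GCplx Lam a 0.
Definition gell (R : realType) (Lam : int) : gcplx R Lam := GCplx Lam 0 1.

Definition gconj (R : realType) (Lam : int) (z : gcplx R Lam) : gcplx R Lam :=
  GCplx Lam (gre z) (- gim z).

(* z is a positive real number *)
Definition gpos (R : realType) (Lam : int) (z : gcplx R Lam) : Prop :=
  gim z = 0 /\ 0 < gre z.

Definition gnorm2 (R : realType) (Lam : int) (z : gcplx R Lam) : gcplx R Lam :=
  z * gconj z.

(* Only the values Lam = -1, 0, 1 are meaningful here. *)
Definition gcos (R : realType) (Lam : int) (t : R) : R :=
  if Lam == -1 then (expR t + expR (- t)) / 2
  else if Lam == 0 then 1 else cos t.
Definition gsin (R : realType) (Lam : int) (t : R) : R :=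
  if Lam == -1 then (expR t - expR (- t)) / 2
  else if Lam == 0 then t else sin t.

(* e^(l t) *)
Definition gexp (R : realType) (Lam : int) (t : R) : gcplx R Lam :=
  GCplx Lam (gcos Lam t) (gsin Lam t).

(** ** Matrices and the spaces X_Lam *)

Notation gmat R Lam := 'M[gcplx R Lam]_2.

Definition mx22 (T : Type) (a b c d : T) : 'M[T]_2 :=
  \matrix_(i < 2, j < 2)
    if i == 0 then (if j == 0 then a else b) else (if j == 0 then c else d).

Definition circ (R : realType) (Lam : int) (x : gmat R Lam) : gmat R Lam :=
  mx22 (gconj (x 1 1)) (- gconj (x 0 1)) (- gconj (x 1 0)) (gconj (x 0 0)).

(* real scalar multiplication *)
Definition rscale (R : realType) (Lam : int) (a : R) (x : gmat R Lam) :
    gmat R Lam := greal Lam a *: x.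

(* A point of the projective space is the class of a matrix modulo R^x. *)
Notation gpoint R Lam := (set (gmat R Lam)).

Definition pt (R : realType) (Lam : int) (x : gmat R Lam) : gpoint R Lam :=
  [set y | exists2 a : R, a != 0 & y = rscale a x].

Definition represents (R : realType) (Lam : int) (x : gmat R Lam) : Prop :=
  circ x = x /\ gpos (\det x).

Definition XLam (R : realType) (Lam : int) : set (gpoint R Lam) :=
  [set pt x | x in [set x | represents x]].

(** ** Isometries *)

(* The maps below are defined on all sets of matrices; they permute the points
   of X_Lam. *)
Definition act_pt (R : realType) (Lam : int) (A : gmat R Lam)
    (p : gpoint R Lam) : gpoint R Lam :=
  [set A *m x *m circ A | x in p].
Definition conj_pt (R : realType) (Lam : int) (p : gpoint R Lam) :
    gpoint R Lam :=
  [set map_mx (@gconj R Lam) x | x in p].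

Definition in_PGLp (R : realType) (Lam : int) (A : gmat R Lam) : Prop :=
  gpos (gnorm2 (\det A)).

(* PGL^+ is not formed as a quotient: [act_pt (z *: A)] and [act_pt A] agree on
   points when z is a unit. *)
Inductive XLam_isometry (R : realType) (Lam : int) :
    (gpoint R Lam -> gpoint R Lam) -> Prop :=
| XLam_isometry_act A : in_PGLp A -> XLam_isometry (act_pt A)
| XLam_isometry_conj : XLam_isometry (@conj_pt R Lam)
| XLam_isometry_id : XLam_isometry id
| XLam_isometry_comp f g :
    XLam_isometry f -> XLam_isometry g -> XLam_isometry (f \o g)
| XLam_isometry_inv f g :
    XLam_isometry f -> cancel f g -> cancel g f -> XLam_isometry g.

(** ** Geodesics and lightlike planes *)

Definition gexpm_partial (R : realType) (Lam : int) (X : gmat R Lam) (n : nat) :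
    gmat R Lam :=
  \sum_(k < n) rscale (k`!%:R^-1) (X ^+ k).

(* matrix exponential, with convergence of the series taken entrywise *)
Definition gexpm (R : realType) (Lam : int) (X : gmat R Lam) : gmat R Lam :=
  \matrix_(i < 2, j < 2)
    GCplx Lam (limn (fun n => gre (gexpm_partial X n i j)))
              (limn (fun n => gim (gexpm_partial X n i j))).

Definition in_xLam (R : realType) (Lam : int) (X : gmat R Lam) : Prop :=
  circ X = X /\ \tr X = 0.

Definition xform (R : realType) (Lam : int) (X : gmat R Lam) : R :=
  - \det (map_mx (@gim R Lam) X).

Definition geodesic (R : realType) (Lam : int) (A X : gmat R Lam) (t : R) :
    gpoint R Lam :=
  act_pt A (pt (gexpm (rscale t X))).

(* [c] is a geodesic whose initial velocity X satisfies P <X, X>.  Constant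
   curves (X = 0) are excluded; they would otherwise count as lightlike. *)
Definition geodesic_of (R : realType) (Lam : int) (P : R -> Prop)
    (c : R -> gpoint R Lam) : Prop :=
  exists A X : gmat R Lam,
    [/\ in_PGLp A, in_xLam X, X <> 0, P (xform X) & c = geodesic A X].

Definition is_geodesic (R : realType) (Lam : int) (c : R -> gpoint R Lam) :=
  geodesic_of (fun=> True) c.
Definition timelike (R : realType) (Lam : int) (c : R -> gpoint R Lam) :=
  geodesic_of (fun q => q < 0) c.
Definition lightlike (R : realType) (Lam : int) (c : R -> gpoint R Lam) :=
  geodesic_of (fun q => q = 0) c.
Definition spacelike (R : realType) (Lam : int) (c : R -> gpoint R Lam) :=
  geodesic_of (fun q => 0 < q) c.
Definition arc_length_parametrized (R : realType) (Lam : int)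
    (c : R -> gpoint R Lam) :=
  geodesic_of (fun q => `|q| = 1) c.

Definition lin_indep (R : realType) (Lam : int) (n : nat)
    (x : 'I_n -> gmat R Lam) : Prop :=
  forall a : 'I_n -> R,
    \sum_(i < n) rscale (a i) (x i) = 0 -> forall i, a i = 0.

Definition rspan (R : realType) (Lam : int) (n : nat)
    (x : 'I_n -> gmat R Lam) : set (gmat R Lam) :=
  [set \sum_(i < n) rscale (a i) (x i) | a in [set: 'I_n -> R]].

Definition geodesic_plane (R : realType) (Lam : int)
    (P : set (gpoint R Lam)) : Prop :=
  exists w : 'I_3 -> gmat R Lam,
    [/\ forall i, circ (w i) = w i, lin_indep w
      & P = @XLam R Lam `&` [set pt x | x in rspan w]].

Definition lightlike_plane (R : realType) (Lam : int)
    (P : set (gpoint R Lam)) : Prop :=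
  [/\ geodesic_plane P,
      exists2 c, lightlike c & forall t, P (c t)
    & ~ exists2 c, timelike c & forall t, P (c t)].

(** ** Lightlike tetrahedra *)

(* the non-zero part of the cone spanned by the x_i with i in S *)
Definition subcone (R : realType) (Lam : int) (x : 'I_4 -> gmat R Lam)
    (S : {set 'I_4}) : set (gmat R Lam) :=
  [set \sum_(i in S) rscale (a i) (x i) | a in
     [set a : 'I_4 -> R | (forall i, 0 <= a i) /\ \sum_(i in S) a i != 0]].

Definition simplex (R : realType) (Lam : int) (x : 'I_4 -> gmat R Lam)
    (S : {set 'I_4}) : set (gpoint R Lam) :=
  [set pt z | z in subcone x S].

Definition tetrahedron (R : realType) (Lam : int) (x : 'I_4 -> gmat R Lam) :=
  simplex x [set: 'I_4].

Definition tetrahedron_interior (R : realType) (Lam : int)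
    (x : 'I_4 -> gmat R Lam) : set (gpoint R Lam) :=
  [set pt (\sum_(i < 4) rscale (a i) (x i)) | a in
     [set a : 'I_4 -> R | forall i, 0 < a i]].

(* The tetrahedron is given by the four spanning vectors x_i, not just by its
   vertices [pt (x i)]: these determine it only up to the signs of the x_i, and
   for Lam = 1 several sign choices give lightlike tetrahedra. *)
Definition lightlike_tetrahedron (R : realType) (Lam : int)
    (x : 'I_4 -> gmat R Lam) : Prop :=
  [/\ lin_indep x,
      forall z, subcone x [set: 'I_4] z -> represents z,
      forall i, exists2 P, lightlike_plane P & simplex x [set~ i] `<=` P
    & forall i c, is_geodesic c -> c 0 = pt (x i) ->
        (exists2 t, 0 <= t & tetrahedron_interior x (c t)) -> spacelike c].

Definition edge (R : realType) (Lam : int) (x : 'I_4 -> gmat R Lam)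
    (i j : 'I_4) : set (gpoint R Lam) := simplex x [set i; j]%SET.

(* r is the arc length of the edge from x_i to x_j *)
Definition edge_length (R : realType) (Lam : int) (x : 'I_4 -> gmat R Lam)
    (i j : 'I_4) (r : R) : Prop :=
  0 <= r /\ exists c : R -> gpoint R Lam,
    [/\ arc_length_parametrized c, c 0 = pt (x i), c r = pt (x j)
      & set_bij [set t | 0 <= t <= r] (edge x i j) c].

Definition edge_lengths (R : realType) (Lam : int) (x : 'I_4 -> gmat R Lam)
    (r : 'I_4 -> 'I_4 -> R) : Prop :=
  forall i j : 'I_4, (i < j)%N -> edge_length x i j (r i j).

Definition edge_seq (R : realType) (r : 'I_4 -> 'I_4 -> R) : seq R :=
  [:: r 0 1; r 0 2; r 0 3; r 1 2; r 1 3; r 2 3].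

Definition std_vertices (R : realType) (Lam : int) (alpha beta gamma : R) :
    'I_4 -> gmat R Lam :=
  fun i => nth 0
   [:: mx22 (gexp Lam alpha) (- (2 * gell R Lam * greal Lam (gsin Lam alpha)))
            0                (gexp Lam (- alpha));
       mx22 (gexp Lam beta)                                0
            (2 * gell R Lam * greal Lam (gsin Lam beta))   (gexp Lam (- beta));
       mx22 (gexp Lam (- gamma)) 0
            0                    (gexp Lam gamma);
       mx22 1 0
            0 1] i.

(* Main.v *)
(* Matrices fixed by [circ] form a real 4-space with quadratic form det; a plane
   of it is lightlike exactly when its covector n is null for the dual quadric
   Lam n0^2 + n1^2 + 4 n2 n3, which makes sense also for Lam = 0.  Move the
   vertex x_4 to 1 and write the others, up to positive factors, as
   c(r_i) + l s(r_i) M_i with M_i in sl(2,R) and <M_i, M_i> = 1, where r_i is the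
   length of the edge from x_4.  The three lightlike faces at x_4 force
   <M_i, M_j> = +-1, and since the M_i are independent the product of the three
   signs is -1.  After permuting vertices <M_1, M_2> = -1, and then a real matrix
   (possibly followed by conjugation) brings M_1, M_2 and +-M_3 to a fixed triple.
   The fourth face gives s(+-r_3 - r_1 - r_2) = 0.  For Lam = 1 the solutions
   other than r_3 = r_1 + r_2 put a null vector into the cone.  So every
   lightlike tetrahedron is isometric to a standard one with lengths
   r_1, r_2, r_1 + r_2, each occurring on a pair of opposite edges, and the
   multiset of lengths determines r_1 and r_2 up to order. *)

From HB Require Import structures.
Require Import Defs.
From mathcomp Require Import all_boot all_order all_algebra fingroup perm.
From mathcomp Require Import all_classical all_reals all_analysis.
From mathcomp Require Import ring lra.
Set Implicit Arguments.
Unset Strict Implicit.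
Unset Printing Implicit Defensive.
Import Order.TTheory GRing.Theory Num.Theory.
Import numFieldNormedType.Exports.
Local Open Scope classical_set_scope.
Local Open Scope ring_scope.

(** * Generalized trigonometric functions *)

(** The case Lam = 0 shapes the setup: there det is the square of the real part, so it neither sees
    lengths nor detects lightlike planes. Hence [bform], the polarized det, is accompanied by
    [kform], its Gram determinant divided by Lam, and planes are tested on covectors; everything is
    polynomial in Lam, which lets one argument serve all curvatures. Inner products of edge
    directions at a vertex are 1 or -1 because a lightlike plane through 1 is cut out of the
    imaginary directions by a plane tangent to the light cone. The form has rank one there, so
    Cauchy-Schwarz becomes an equality. Signs need care throughout: points are classes modulo R^x,
    but a tetrahedron is the image of a cone. Single vertices may be rescaled only positively,
    whereas a global sign is harmless. Likewise, that a geodesic between two vertices follows the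
    edge and not the complementary arc of its projective line must be extracted from the edge
    condition. *)

Section GeneralizedTrigonometry.
Variables (R : realType) (Lam : int).
Hypothesis hLam : Lam \in [:: -1; 0; 1].
Notation c := (@gcos R Lam).
Notation s := (@gsin R Lam).
Notation L := (Lam%:~R : R).

Lemma LamP : [\/ Lam = -1, Lam = 0 | Lam = 1].
Proof.
move: hLam; rewrite !inE => /or3P[] /eqP ->;
  by [constructor 1|constructor 2|constructor 3].
Qed.

Lemma gcosD x y : c (x + y) = c x * c y - L * (s x * s y).
Proof.
case: LamP => ->; rewrite /gcos /gsin /=.
- by rewrite opprD !expRD; field.
- by ring.
- by rewrite cosD; ring.
Qed.

Lemma gsinD x y : s (x + y) = s x * c y + c x * s y.
Proof.
case: LamP => ->; rewrite /gcos /gsin /=.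
- by rewrite opprD !expRD; field.
- by ring.
- by rewrite sinD; ring.
Qed.

Lemma gcosN x : c (- x) = c x.
Proof.
case: LamP => ->; rewrite /gcos /gsin /= ?opprK ?cosN //.
by rewrite addrC.
Qed.

Lemma gsinN x : s (- x) = - s x.
Proof.
case: LamP => ->; rewrite /gcos /gsin /= ?opprK ?sinN //.
by rewrite -mulNr opprB.
Qed.

Lemma gcos0 : c 0 = 1.
Proof.
case: LamP => ->; rewrite /gcos /= ?oppr0 ?expR0 ?cos0 //.
by field.
Qed.

Lemma gsin0 : s 0 = 0.
Proof. by apply: (@mulfI _ 2) => //; have := gsinN 0; rewrite oppr0; lra. Qed.

Lemma gcos2Dsin2 x : c x ^+ 2 + L * s x ^+ 2 = 1.
Proof. by rewrite -[RHS]gcos0 -(subrr x) gcosD gcosN gsinN; ring. Qed.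

Lemma gsinB x y : s (x - y) = s x * c y - c x * s y.
Proof. by rewrite gsinD gcosN gsinN; ring. Qed.

Lemma gcosB x y : c (x - y) = c x * c y + L * (s x * s y).
Proof. by rewrite gcosD gcosN gsinN; ring. Qed.

Lemma gsin_gt0 x : 0 < x -> (Lam = 1 -> x < pi) -> 0 < s x.
Proof.
case: LamP => -> x0 xpi; rewrite /gsin /= //.
- by rewrite divr_gt0 // subr_gt0 ltr_expR; lra.
- by apply: sin_gt0_pi; rewrite x0 xpi.
Qed.

Lemma gcos_gsin_inj x y : 0 < x -> 0 < y ->
  (Lam = 1 -> x < pi) -> (Lam = 1 -> y < pi) -> c x = c y -> s x = s y -> x = y.
Proof.
move=> x0 y0 xpi ypi ec es.
have e : s (x - y) = 0 by rewrite gsinB ec es; ring.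
have [xy|yx|//] := ltgtP x y.
- have : 0 < s (y - x) by apply: gsin_gt0 => [|/ypi]; lra.
  by rewrite -opprB gsinN e oppr0 ltxx.
- have : 0 < s (x - y) by apply: gsin_gt0 => [|/xpi]; lra.
  by rewrite e ltxx.
Qed.

(** The pairs [(s (r - t), s t)] are the coefficients of a geodesic point with respect to the two
    endpoints. Their 2x2 determinant is [s r * s (t - t')], so pairs with the same ratio belong to
    the same parameter; this makes edges injectively parametrized. *)
Lemma gsin_interp r t t' : s t * s (r - t') - s t' * s (r - t) = s r * s (t - t').
Proof.
rewrite !gsinB.
transitivity (s r * (s t * c t' - c t * s t')); last by [].
ring.
Qed.

Lemma continuous_gsin : continuous s.
Proof.
case: LamP => ->; rewrite /gsin /= => x.
- apply: cvgM; last exact: cvg_cst.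
  apply: cvgB; first exact: continuous_expR.
  by apply: continuous_comp; [exact: opp_continuous|exact: continuous_expR].
- exact: cvg_id.
- exact: continuous_sin.
Qed.

End GeneralizedTrigonometry.

(** * Power series of the generalized cosine and sine *)

Section ExpSeries.
Variables (R : realType) (Lam : int).
Hypothesis hLam : Lam \in [:: -1; 0; 1].

(** The even terms of exp(l t) with l^2 = -Lam; [gsin_coeff] collects the odd ones with a factor l
    removed. For Lam = 0 the convention 0^0 = 1 leaves a single term in each. *)
Definition gcos_coeff (t : R) (n : nat) : R :=
  (~~ odd n)%:R * (- Lam%:~R) ^+ n./2 * t ^+ n / n`!%:R.
Definition gsin_coeff (t : R) (n : nat) : R :=
  (odd n)%:R * (- Lam%:~R) ^+ n./2 * t ^+ n / n`!%:R.

Lemma cvg_gcos_coeff t : series (gcos_coeff t) @ \oo --> gcos Lam t.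
Proof.
case: (LamP hLam) => eL; rewrite /gcos eL /=.
- have -> : series (gcos_coeff t) =
      (fun n => (series (exp_coeff t) n + series (exp_coeff (- t)) n) / 2).
    apply/funext => n; rewrite /series /= -big_split /= mulr_suml.
    apply: eq_bigr => k _; rewrite /gcos_coeff /exp_coeff /= eL /= mulrN1z opprK.
    rewrite expr1n exprNn -signr_odd; case: (odd k) => /=; first by field.
    by rewrite expr0; field.
  apply: cvgM; last exact: cvg_cst.
  by apply: cvgD; exact: is_cvg_series_exp_coeff.
- apply: cvg_near_cst; exists 1%N => //= -[//|n] _.
  rewrite /series /= big_nat_recl // big1 ?addr0.
    by rewrite /gcos_coeff eL /= !expr0 fact0 divr1 !mulr1.
  move=> k _; rewrite /gcos_coeff eL /= oppr0.
  by case: k => [|k] /=; rewrite ?mul0r ?exprS ?(mul0r,mulr0).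
- have -> : series (gcos_coeff t) = series (cos_coeff t).
    apply/funext => n; apply: eq_bigr => k _.
    by rewrite /gcos_coeff /cos_coeff /= eL.
  by rewrite unlock; exact: is_cvg_series_cos_coeff.
Qed.

Lemma cvg_gsin_coeff t : series (gsin_coeff t) @ \oo --> gsin Lam t.
Proof.
case: (LamP hLam) => eL; rewrite /gsin eL /=.
- have -> : series (gsin_coeff t) =
      (fun n => (series (exp_coeff t) n - series (exp_coeff (- t)) n) / 2).
    apply/funext => n; rewrite /series /= -sumrB /= mulr_suml.
    apply: eq_bigr => k _; rewrite /gsin_coeff /exp_coeff /= eL /= mulrN1z opprK.
    rewrite expr1n exprNn -signr_odd; case: (odd k) => /=; first by field.
    by rewrite expr0; field.
  apply: cvgM; last exact: cvg_cst.
  by apply: cvgB; exact: is_cvg_series_exp_coeff.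
- apply: cvg_near_cst; exists 2%N => //= -[//|[//|n]] _.
  rewrite /series /= 2?big_nat_recl // big1 ?addr0.
    by rewrite /gsin_coeff /= !mul0r add0r mul1r expr0 expr1 mul1r divr1.
  move=> k _; rewrite /gsin_coeff eL /= oppr0.
  by rewrite ?mul0r ?exprS ?(mul0r,mulr0).
- have -> : series (gsin_coeff t) = series (sin_coeff t).
    apply/funext => n; apply: eq_bigr => k _.
    rewrite /gsin_coeff /sin_coeff /= eL; case: k => //= k.
    by rewrite uphalf_half; case: (odd k) => /=; rewrite ?mul0r ?add0n.
  by rewrite unlock; exact: is_cvg_series_sin_coeff.
Qed.
End ExpSeries.

(** * Hermitian matrices and the action of PGL+ *)

Section Matrix22.
Variables (K : comNzRingType).
Implicit Types (x y : 'M[K]_2).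

Lemma mx22_eta (T : Type) (x : 'M[T]_2) : x = mx22 (x 0 0) (x 0 1) (x 1 0) (x 1 1).
Proof.
apply/matrixP => i j; rewrite mxE.
case: i => [[|[|//]] ?]; case: j => [[|[|//]] ?] /=;
  by congr (x _ _); exact: val_inj.
Qed.

Lemma mx22_mul (a b c d a' b' c' d' : K) :
  mx22 a b c d *m mx22 a' b' c' d' =
  mx22 (a * a' + b * c') (a * b' + b * d') (c * a' + d * c') (c * b' + d * d').
Proof.
rewrite [LHS]mx22_eta !mxE !big_ord_recl !big_ord0 !mxE /=.
by rewrite !addr0.
Qed.

Lemma mx22_scale (k a b c d : K) :
  k *: mx22 a b c d = mx22 (k * a) (k * b) (k * c) (k * d).
Proof. by rewrite [LHS]mx22_eta !mxE. Qed.

Lemma mx22_add (a b c d a' b' c' d' : K) :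
  mx22 a b c d + mx22 a' b' c' d' = mx22 (a + a') (b + b') (c + c') (d + d').
Proof. by rewrite [LHS]mx22_eta !mxE. Qed.

Lemma mx22_det (a b c d : K) : \det (mx22 a b c d) = a * d - b * c.
Proof.
rewrite (expand_det_row _ 0) !big_ord_recl big_ord0 /cofactor !det_mx11 !mxE /=.
by rewrite !expr0 !mul1r addr0 expr1 mulN1r mulrN.
Qed.

Lemma mx22_1 : 1%:M = mx22 1 0 0 1 :> 'M[K]_2.
Proof. by rewrite [LHS]mx22_eta !mxE. Qed.
End Matrix22.

Section Hermitian.
Variables (R : realType) (Lam : int).
Notation L := (Lam%:~R : R).
Notation gc := (gcplx R Lam).
Notation row4R := 'rV[R]_4.

Lemma gmulE (a b c d : R) : GCplx Lam a b * GCplx Lam c d =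
  GCplx Lam (a * c - L * (b * d)) (a * d + b * c).
Proof. by []. Qed.

Lemma gaddE (a b c d : R) : GCplx Lam a b + GCplx Lam c d =
  GCplx Lam (a + c) (b + d).
Proof. by []. Qed.

Lemma goppE (a b : R) : - GCplx Lam a b = GCplx Lam (- a) (- b).
Proof. by []. Qed.

Lemma gconjE (a b : R) : gconj (GCplx Lam a b) = GCplx Lam a (- b).
Proof. by []. Qed.

Lemma gzeroE : 0 = GCplx Lam 0 0 :> gc.
Proof. by []. Qed.

Lemma goneE : 1 = GCplx Lam 1 0 :> gc.
Proof. by []. Qed.

Definition gE := (gmulE, gaddE, goppE, gconjE).

Lemma gconjD (z w : gc) : gconj (z + w) = gconj z + gconj w.
Proof. by case: z w => [a b] [c d]; rewrite !gE; congr GCplx; ring. Qed.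

Lemma gconjM (z w : gc) : gconj (z * w) = gconj z * gconj w.
Proof. by case: z w => [a b] [c d]; rewrite !gE; congr GCplx; ring. Qed.

Lemma gconjN (z : gc) : gconj (- z) = - gconj z.
Proof. by case: z. Qed.

Lemma gconjK : involutive (@gconj R Lam).
Proof. by move=> [a b]; rewrite !gE opprK. Qed.

Lemma greal_mul a b : greal Lam (a * b) = greal Lam a * greal Lam b :> gc.
Proof. by rewrite /greal gE; congr GCplx; ring. Qed.

Lemma rscaleA a b (x : gmat R Lam) : rscale a (rscale b x) = rscale (a * b) x.
Proof. by rewrite /rscale scalerA greal_mul. Qed.

Lemma rscale1 (x : gmat R Lam) : rscale 1 x = x.
Proof. by rewrite /rscale scale1r. Qed.

Definition c0 (v : row4R) := v 0 0.
Definition c1 (v : row4R) := v 0 1.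
Definition c2 (v : row4R) := v 0 2.
Definition c3 (v : row4R) := v 0 3.

Definition row4 (p q b c : R) : row4R := \row_(j < 4) nth 0 [:: p; q; b; c] j.

Lemma c0_row4 p q b c : c0 (row4 p q b c) = p. Proof. by rewrite /c0 mxE. Qed.
Lemma c1_row4 p q b c : c1 (row4 p q b c) = q. Proof. by rewrite /c1 mxE. Qed.
Lemma c2_row4 p q b c : c2 (row4 p q b c) = b. Proof. by rewrite /c2 mxE. Qed.
Lemma c3_row4 p q b c : c3 (row4 p q b c) = c. Proof. by rewrite /c3 mxE. Qed.

Lemma c0D u v : c0 (u + v) = c0 u + c0 v. Proof. by rewrite /c0 mxE. Qed.
Lemma c1D u v : c1 (u + v) = c1 u + c1 v. Proof. by rewrite /c1 mxE. Qed.
Lemma c2D u v : c2 (u + v) = c2 u + c2 v. Proof. by rewrite /c2 mxE. Qed.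
Lemma c3D u v : c3 (u + v) = c3 u + c3 v. Proof. by rewrite /c3 mxE. Qed.
Lemma c0Z a v : c0 (a *: v) = a * c0 v. Proof. by rewrite /c0 mxE. Qed.
Lemma c1Z a v : c1 (a *: v) = a * c1 v. Proof. by rewrite /c1 mxE. Qed.
Lemma c2Z a v : c2 (a *: v) = a * c2 v. Proof. by rewrite /c2 mxE. Qed.
Lemma c3Z a v : c3 (a *: v) = a * c3 v. Proof. by rewrite /c3 mxE. Qed.
Lemma c0N v : c0 (- v) = - c0 v. Proof. by rewrite /c0 mxE. Qed.
Lemma c1N v : c1 (- v) = - c1 v. Proof. by rewrite /c1 mxE. Qed.
Lemma c2N v : c2 (- v) = - c2 v. Proof. by rewrite /c2 mxE. Qed.
Lemma c3N v : c3 (- v) = - c3 v. Proof. by rewrite /c3 mxE. Qed.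
Lemma c0_0 : c0 0 = 0. Proof. by rewrite /c0 mxE. Qed.
Lemma c1_0 : c1 0 = 0. Proof. by rewrite /c1 mxE. Qed.
Lemma c2_0 : c2 0 = 0. Proof. by rewrite /c2 mxE. Qed.
Lemma c3_0 : c3 0 = 0. Proof. by rewrite /c3 mxE. Qed.

Definition cE := (c0_row4, c1_row4, c2_row4, c3_row4, c0D, c1D, c2D, c3D,
  c0Z, c1Z, c2Z, c3Z, (c0N, c1N, c2N, c3N), (c0_0, c1_0, c2_0, c3_0)).

Lemma row4P u v : c0 u = c0 v -> c1 u = c1 v -> c2 u = c2 v -> c3 u = c3 v -> u = v.
Proof.
rewrite /c0 /c1 /c2 /c3 => h0 h1 h2 h3; apply/rowP => j.
case: j => [[|[|[|[|//]]]] hj].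
- by rewrite [Ordinal _](_ : _ = 0) //; apply: val_inj.
- by rewrite [Ordinal _](_ : _ = 1) //; apply: val_inj.
- by rewrite [Ordinal _](_ : _ = 2) //; apply: val_inj.
- by rewrite [Ordinal _](_ : _ = 3) //; apply: val_inj.
Qed.

(* [row4 p q b c] is the coordinate vector of [[p + l q, l b], [l c, p - l q]], the
   general form of a matrix fixed by [circ]. *)
Definition hm (v : row4R) : gmat R Lam :=
  mx22 (GCplx Lam (c0 v) (c1 v)) (GCplx Lam 0 (c2 v))
       (GCplx Lam 0 (c3 v)) (GCplx Lam (c0 v) (- c1 v)).

Definition hv (x : gmat R Lam) : row4R :=
  row4 (gre (x 0 0)) (gim (x 0 0)) (gim (x 0 1)) (gim (x 1 0)).

Lemma hmK : cancel hm hv.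
Proof. by move=> v; apply: row4P; rewrite !cE mxE. Qed.

Lemma circ_mx22 (a b c d : gc) :
  circ (mx22 a b c d) = mx22 (gconj d) (- gconj b) (- gconj c) (gconj a).
Proof. by rewrite /circ !mxE. Qed.

Lemma hvK x : circ x = x -> hm (hv x) = x.
Proof.
rewrite (mx22_eta x).
case: (x 0 0) (x 0 1) (x 1 0) (x 1 1) => [a a'] [b b'] [c c'] [d d'].
rewrite circ_mx22 => /matrixP e.
have := e 0 0; have := e 0 1; have := e 1 0; rewrite !mxE /= !gE.
move=> [hc _] [hb _] [hd hd']; rewrite /hm !cE !mxE /=; congr mx22; congr GCplx; lra.
Qed.

Lemma circ_hm v : circ (hm v) = hm v.
Proof. by rewrite /hm circ_mx22 !gE !oppr0 !opprK. Qed.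

Lemma hmD u v : hm (u + v) = hm u + hm v.
Proof. by rewrite /hm mx22_add !gE !cE; congr mx22; congr GCplx; ring. Qed.

Lemma hmZ a v : hm (a *: v) = rscale a (hm v).
Proof.
by rewrite /hm /rscale mx22_scale /greal !gE !cE; congr mx22; congr GCplx; ring.
Qed.

Lemma hm0 : hm 0 = 0.
Proof. by rewrite -[X in hm X](scale0r (0 : row4R)) hmZ /rscale scale0r. Qed.

Lemma hm_inj : injective hm.
Proof. exact: can_inj hmK. Qed.

Lemma hm_sum (I : Type) (r : seq I) (P : pred I) (F : I -> row4R) :
  hm (\sum_(i <- r | P i) F i) = \sum_(i <- r | P i) hm (F i).
Proof. exact: (big_morph hm hmD hm0). Qed.

(** The polarization of minus the determinant of the imaginary part, hence the form <X, X> on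
    traceless matrices; [bform] polarizes the determinant itself. *)
Definition iform u v : R := c1 u * c1 v + (c2 u * c3 v + c3 u * c2 v) / 2.
Definition bform u v : R := c0 u * c0 v + L * iform u v.
Definition kform u v : R :=
  c0 u ^+ 2 * iform v v + c0 v ^+ 2 * iform u u - 2 * c0 u * c0 v * iform u v +
  L * (iform u u * iform v v - iform u v ^+ 2).

Lemma iformC u v : iform u v = iform v u. Proof. by rewrite /iform; ring. Qed.
Lemma bformC u v : bform u v = bform v u. Proof. by rewrite /bform iformC; ring. Qed.
Lemma kformC u v : kform u v = kform v u. Proof. by rewrite /kform (iformC u v); ring. Qed.

Lemma iformZl a u v : iform (a *: u) v = a * iform u v. Proof. by rewrite /iform !cE; field. Qed.
Lemma iformZr a u v : iform u (a *: v) = a * iform u v. Proof. by rewrite /iform !cE; field. Qed.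

(* Multiplied by [L], [kform] is a Gram determinant of [bform]; for [Lam = 0] it is
   the remaining invariant of a pair of points. *)
Lemma kformE u v : L * kform u v = bform u u * bform v v - bform u v ^+ 2.
Proof. by rewrite /kform /bform; ring. Qed.

Lemma bformDl u v w : bform (u + v) w = bform u w + bform v w.
Proof. by rewrite /bform /iform !cE; field. Qed.
Lemma bformZl a v w : bform (a *: v) w = a * bform v w.
Proof. by rewrite /bform /iform !cE; field. Qed.
Lemma bformDr u v w : bform w (u + v) = bform w u + bform w v.
Proof. by rewrite /bform /iform !cE; field. Qed.
Lemma bformZr a v w : bform w (a *: v) = a * bform w v.
Proof. by rewrite /bform /iform !cE; field. Qed.
Lemma kformZl a v w : kform (a *: v) w = a ^+ 2 * kform v w.
Proof. by rewrite /kform /iform !cE; field. Qed.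
Lemma kformZr a v w : kform w (a *: v) = a ^+ 2 * kform w v.
Proof. by rewrite /kform /iform !cE; field. Qed.
(** As for any Gram determinant, a multiple of one vector may be added to the other. It removes the
    cosine part of a geodesic point. *)
Lemma kformDr a v w : kform w (a *: w + v) = kform w v.
Proof. by rewrite /kform /iform !cE; field. Qed.

Lemma det_hm v : \det (hm v) = greal Lam (bform v v).
Proof. by rewrite /hm mx22_det !gE /greal /bform /iform; congr GCplx => /=; field. Qed.

Lemma represents_hm v : represents (hm v) <-> 0 < bform v v.
Proof.
rewrite /represents det_hm /gpos circ_hm /=.
by split=> [[_ []]|].
Qed.

Lemma representsP x : represents x -> hm (hv x) = x /\ 0 < bform (hv x) (hv x).
Proof.
move=> hx; have e : hm (hv x) = x by apply: hvK; case: hx.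
by split=> //; apply/represents_hm; rewrite e.
Qed.

Lemma circM (x y : gmat R Lam) : circ (x *m y) = circ y *m circ x.
Proof.
rewrite (mx22_eta x) (mx22_eta y) mx22_mul !circ_mx22 mx22_mul.
by rewrite !(gconjD, gconjM); congr mx22; ring.
Qed.

Lemma circK : involutive (@circ R Lam).
Proof.
by move=> x; rewrite (mx22_eta x) !circ_mx22 !gconjN !gconjK !opprK.
Qed.

Lemma circ1 : circ 1%:M = 1%:M :> gmat R Lam.
Proof. by rewrite mx22_1 circ_mx22 goneE gzeroE !gE !oppr0. Qed.

End Hermitian.

(** The action in coordinates. It is opened only in [hm_Tact] and [TactE]; elsewhere it is an
    abstract linear map. *)
HB.lock Definition Tact (R : realType) (Lam : int) (A : gmat R Lam)
    (v : 'rV[R]_4) : 'rV[R]_4 := hv (A *m hm Lam v *m circ A).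

Section Action.
Variables (R : realType) (Lam : int).
Notation row4R := 'rV[R]_4.
Notation hm := (@hm R Lam).
Implicit Types (A B : gmat R Lam) (u v : row4R).

Lemma hm_Tact A v : hm (Tact A v) = A *m hm v *m circ A.
Proof. by rewrite Tact.unlock hvK // !circM circK circ_hm mulmxA. Qed.

Lemma TactD A u v : Tact A (u + v) = Tact A u + Tact A v.
Proof. by apply: (@hm_inj R Lam); rewrite hmD !hm_Tact hmD mulmxDr mulmxDl. Qed.

Lemma TactZ A a v : Tact A (a *: v) = a *: Tact A v.
Proof.
by apply: (@hm_inj R Lam); rewrite hmZ !hm_Tact hmZ /rscale -scalemxAr -scalemxAl.
Qed.

Lemma TactN A v : Tact A (- v) = - Tact A v.
Proof. by rewrite -scaleN1r TactZ scaleN1r. Qed.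

Lemma Tact_mul A B v : Tact (A *m B) v = Tact A (Tact B v).
Proof. by apply: (@hm_inj R Lam); rewrite !hm_Tact circM !mulmxA. Qed.

Lemma Tact1 v : Tact (1%:M : gmat R Lam) v = v.
Proof. by apply: (@hm_inj R Lam); rewrite hm_Tact circ1 mul1mx mulmx1. Qed.

End Action.

(** * Behaviour of the forms and of covectors under the action *)

Section Similarities.
Variables (R : realType) (Lam : int).
Notation L := (Lam%:~R : R).
Notation gc := (gcplx R Lam).
Notation row4R := 'rV[R]_4.
Notation bform := (@bform R Lam).
Notation kform := (@kform R Lam).
Notation Tact := (@Tact R Lam).

Definition dnorm (A : gmat R Lam) : R := gre (gnorm2 (\det A)).

Lemma gnorm2_real (z : gc) : gnorm2 z = greal Lam (gre (gnorm2 z)).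
Proof. by case: z => a b; rewrite /gnorm2 !gE /greal; congr GCplx => /=; ring. Qed.

Lemma gnorm2M (z w : gc) : gnorm2 (z * w) = gnorm2 z * gnorm2 w.
Proof. by rewrite /gnorm2 gconjM; ring. Qed.

Lemma in_PGLpP A : in_PGLp A <-> 0 < dnorm A.
Proof. by rewrite /in_PGLp gnorm2_real /gpos /=; split=> [[]|]. Qed.

Lemma det_circ (A : gmat R Lam) : \det (circ A) = gconj (\det A).
Proof.
by rewrite (mx22_eta A) circ_mx22 !mx22_det gconjD gconjN !gconjM; ring.
Qed.

(** Multiplicativity of det, with [det (circ A)] conjugate to [det A], gives the quadratic form;
    polarization gives the rest. *)
Lemma bform_Tact A u v : bform (Tact A u) (Tact A v) = dnorm A * bform u v.
Proof.
have q w : bform (Tact A w) (Tact A w) = dnorm A * bform w w.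
  have := det_hm Lam (Tact A w).
  rewrite hm_Tact !det_mulmx det_circ det_hm mulrAC -/(gnorm2 _) gnorm2_real.
  by rewrite -greal_mul => -[].
have := q (u + v).
rewrite TactD !(bformDl, bformDr) (q u) (q v) (bformC Lam v u) (bformC Lam (Tact A v) (Tact A u)).
lra.
Qed.

(** Writing a for a + l a' and so on, [X + l X'] is a times the conjugate of d; [Y], [Z], [W], [S],
    [T] arise in the same way from the pairs (b, d), (a, c), (b, c), (a, b), (c, d). *)
Lemma TactE (a a' b b' c c' d d' p q x y : R) :
  Tact (mx22 (GCplx Lam a a') (GCplx Lam b b') (GCplx Lam c c') (GCplx Lam d d'))
    (row4 p q x y) =
  let X := a * d + L * (a' * d') in let X' := a' * d - a * d' in
  let Y := b * d + L * (b' * d') in let Y' := b' * d - b * d' in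
  let Z := a * c + L * (a' * c') in let Z' := a' * c - a * c' in
  let W := b * c + L * (b' * c') in let W' := b' * c - b * c' in
  let S := a * b + L * (a' * b') in let S' := a' * b - a * b' in
  let T := c * d + L * (c' * d') in let T' := c' * d - c * d' in
  row4 ((X - W) * p + L * (Z' * x - Y' * y - (X' + W') * q))
    ((X' - W') * p + (X + W) * q - Z * x + Y * y)
    ((a ^+ 2 + L * a' ^+ 2) * x - (b ^+ 2 + L * b' ^+ 2) * y - 2 * (S' * p + S * q))
    ((d ^+ 2 + L * d' ^+ 2) * y - (c ^+ 2 + L * c' ^+ 2) * x + 2 * (T' * p + T * q)).
Proof.
rewrite Tact.unlock /hm !cE circ_mx22 !mx22_mul /hv !mxE /=.
by apply: row4P; rewrite !cE /=; ring.
Qed.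

Lemma gmat_eta (A : gmat R Lam) :
  exists a a' b b' c c' d d' : R, A =
    mx22 (GCplx Lam a a') (GCplx Lam b b') (GCplx Lam c c') (GCplx Lam d d').
Proof.
rewrite (mx22_eta A).
case: (A 0 0) (A 0 1) (A 1 0) (A 1 1) => [a a'] [b b'] [c c'] [d d'].
by exists a, a', b, b', c, c', d, d'.
Qed.

Lemma row4_eta (v : row4R) : v = row4 (c0 v) (c1 v) (c2 v) (c3 v).
Proof. by apply: row4P; rewrite !cE. Qed.

(** For Lam != 0, divide the Gram determinant of [bform] by Lam. For Lam = 0, [kform] is the
    Minkowski norm of the difference of the two points after cross-multiplying by their first
    coordinates; this difference has first coordinate 0, and on such vectors A acts through its real
    part alone. *)
Lemma kform_Tact A u v : kform (Tact A u) (Tact A v) = dnorm A ^+ 2 * kform u v.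
Proof.
have [e|L0] := eqVneq Lam 0; last first.
  have nz : L != 0 by rewrite intr_eq0.
  apply: (mulfI nz); rewrite kformE !bform_Tact.
  transitivity (dnorm A ^+ 2 * (L * kform u v)); last by ring.
  by rewrite kformE; ring.
have L0 : L = 0 by rewrite e.
have K0 x y : kform x y = iform (c0 x *: y - c0 y *: x) (c0 x *: y - c0 y *: x).
  by rewrite /kform L0 /iform !cE; field.
have [a [a' [b [b' [c [c' [d [d' eA]]]]]]]] := gmat_eta A.
have dA : dnorm A = (a * d - b * c) ^+ 2.
  by rewrite eA /dnorm mx22_det /gnorm2 /= L0; ring.
have p w : c0 (Tact A w) = (a * d - b * c) * c0 w.
  by rewrite eA (row4_eta w) TactE !cE L0; ring.
have I0 w : c0 w = 0 -> iform (Tact A w) (Tact A w) = dnorm A * iform w w.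
  by move=> w0; rewrite dA eA (row4_eta w) TactE /iform !cE w0 L0; field.
rewrite !K0 !p.
have -> : ((a * d - b * c) * c0 u) *: Tact A v -
    ((a * d - b * c) * c0 v) *: Tact A u =
    (a * d - b * c) *: Tact A (c0 u *: v - c0 v *: u).
  by rewrite TactD TactN !TactZ; apply: row4P; rewrite !cE; ring.
transitivity (dnorm A * iform (Tact A (c0 u *: v - c0 v *: u))
  (Tact A (c0 u *: v - c0 v *: u))); first by rewrite dA /iform !cE; field.
rewrite I0; first by ring.
by rewrite !cE; ring.
Qed.

Definition pr (n v : row4R) : R :=
  c0 n * c0 v + c1 n * c1 v + c2 n * c2 v + c3 n * c3 v.

(* The quadric dual to [bform], normalized so that it stays meaningful for [Lam = 0]. *)
Definition dualq (n : row4R) : R := L * c0 n ^+ 2 + c1 n ^+ 2 + 4 * c2 n * c3 n.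

Definition pull (A : gmat R Lam) (n : row4R) : row4R :=
  row4 (pr n (Tact A (row4 1 0 0 0))) (pr n (Tact A (row4 0 1 0 0)))
       (pr n (Tact A (row4 0 0 1 0))) (pr n (Tact A (row4 0 0 0 1))).

Lemma prD n u v : pr n (u + v) = pr n u + pr n v.
Proof. by rewrite /pr !cE; ring. Qed.

Lemma prZ n a v : pr n (a *: v) = a * pr n v.
Proof. by rewrite /pr !cE; ring. Qed.

Lemma row4_decomp (v : row4R) : v = c0 v *: row4 1 0 0 0 + c1 v *: row4 0 1 0 0 +
  c2 v *: row4 0 0 1 0 + c3 v *: row4 0 0 0 1.
Proof. by apply: row4P; rewrite !cE; ring. Qed.

Lemma pr_pull A n v : pr (pull A n) v = pr n (Tact A v).
Proof.
rewrite [X in _ = pr n (Tact A X)]row4_decomp !TactD !TactZ !prD !prZ.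
by rewrite /pull [LHS]/pr !cE; ring.
Qed.

(** For Lam != 0, [dualq] is Lam times the inverse of the Gram matrix of [bform], so it is scaled by
    the same factor; as a polynomial identity this persists for Lam = 0. *)
Lemma dualq_pull A n : dualq (pull A n) = dnorm A * dualq n.
Proof.
have [a [a' [b [b' [c [c' [d [d' ->]]]]]]]] := gmat_eta A.
rewrite /dualq /pull !TactE /pr !cE /dnorm mx22_det /gnorm2 /=.
ring.
Qed.

(* [gcplx] is only declared as a commutative ring, so [invmx] is not available. *)
Definition ginvmx (A : gmat R Lam) : gmat R Lam :=
  (greal Lam (dnorm A)^-1 * gconj (\det A)) *: \adj A.

Lemma ginvmx_scalar A : 0 < dnorm A ->
  greal Lam (dnorm A)^-1 * gconj (\det A) * \det A = 1.
Proof.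
move=> dA; rewrite -mulrA (mulrC _ (\det A)) -/(gnorm2 _) gnorm2_real.
by rewrite -greal_mul mulVf // gt_eqF.
Qed.

Lemma mul_ginvmx A : 0 < dnorm A -> ginvmx A *m A = 1%:M.
Proof.
by move=> dA; rewrite -scalemxAl mul_adj_mx scale_scalar_mx ginvmx_scalar.
Qed.

Lemma mulmx_ginv A : 0 < dnorm A -> A *m ginvmx A = 1%:M.
Proof.
by move=> dA; rewrite -scalemxAr mul_mx_adj scale_scalar_mx ginvmx_scalar.
Qed.

Lemma dnorm_ginvmx A : 0 < dnorm A -> 0 < dnorm (ginvmx A).
Proof.
move=> dA; have := congr1 (fun B => dnorm B) (mul_ginvmx dA).
rewrite /dnorm det_mulmx det1 gnorm2M.
rewrite (gnorm2_real (\det (ginvmx A))) (gnorm2_real (\det A)) -greal_mul /=.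
rewrite -/(dnorm A) -/(dnorm (ginvmx A)) => e.
by rewrite -(pmulr_lgt0 _ dA) e oppr0 !mulr0 subr0 mulr1 ltr01.
Qed.

Lemma TactK A : 0 < dnorm A -> cancel (Tact A) (Tact (ginvmx A)).
Proof. by move=> dA v; rewrite -Tact_mul mul_ginvmx // Tact1. Qed.

Lemma TactKV A : 0 < dnorm A -> cancel (Tact (ginvmx A)) (Tact A).
Proof. by move=> dA v; rewrite -Tact_mul mulmx_ginv // Tact1. Qed.

Lemma Tact0 A : Tact A 0 = 0.
Proof. by rewrite -[X in Tact A X](scale0r (0 : row4R)) TactZ scale0r. Qed.

End Similarities.

(** * Projective points and the similarities inducing isometries *)

Section Points.
Variables (R : realType) (Lam : int).
Notation row4R := 'rV[R]_4.
Notation hm := (@hm R Lam).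
Notation bform := (@bform R Lam).
Notation kform := (@kform R Lam).
Notation dualq := (@dualq R Lam).

Lemma ptP (x y : gmat R Lam) : pt x = pt y <-> exists2 a : R, a != 0 & y = rscale a x.
Proof.
split=> [e|[a a0 ->]].
  have : pt y y by exists 1; rewrite ?oner_neq0 // rscale1.
  by rewrite -e => -[a a0 ->]; exists a.
apply/seteqP; split=> z [b b0 ->].
  exists (b / a); first by rewrite mulf_neq0 ?invr_neq0.
  by rewrite rscaleA divfK.
by exists (b * a); rewrite ?mulf_neq0 // rscaleA.
Qed.

Lemma pt_hmP (u v : row4R) : pt (hm u) = pt (hm v) <-> exists2 a : R, a != 0 & v = a *: u.
Proof.
split=> [/ptP[a a0]|[a a0 ->]].
  by rewrite -hmZ => /hm_inj ->; exists a.
by apply/ptP; exists a; rewrite // hmZ.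
Qed.

Lemma act_pt_hm A (v : row4R) : act_pt A (pt (hm v)) = pt (hm (Tact A v)).
Proof.
apply/seteqP; split=> [z [_ [a a0 ->]] <-|z [a a0 ->]].
  by exists a; rewrite // -hmZ -hm_Tact TactZ hmZ.
exists (rscale a (hm v)); first by exists a.
by rewrite -hmZ -hm_Tact TactZ hmZ.
Qed.

Definition cconj (v : row4R) : row4R := row4 (c0 v) (- c1 v) (- c2 v) (- c3 v).

Lemma map_gconj_hm v : map_mx (@gconj R Lam) (hm v) = hm (cconj v).
Proof.
rewrite [LHS]mx22_eta !mxE /= /hm !cE !gE.
by congr mx22; congr GCplx => /=; rewrite ?oppr0.
Qed.

Lemma cconjZ a v : cconj (a *: v) = a *: cconj v.
Proof. by apply: row4P; rewrite !cE; ring. Qed.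

Lemma cconjD u v : cconj (u + v) = cconj u + cconj v.
Proof. by apply: row4P; rewrite !cE; ring. Qed.

Lemma conj_pt_hm v : conj_pt (pt (hm v)) = pt (hm (cconj v)).
Proof.
apply/seteqP; split=> [z [_ [a a0 ->]] <-|z [a a0 ->]].
  by exists a; rewrite // -hmZ map_gconj_hm cconjZ hmZ.
exists (rscale a (hm v)); first by exists a.
by rewrite -hmZ map_gconj_hm cconjZ hmZ.
Qed.

Lemma act_ptK A : 0 < dnorm A -> cancel (@act_pt R Lam A) (act_pt (ginvmx A)).
Proof.
move=> dA p; apply/seteqP; split=> [z [_ [x px <-] <-]|x px].
  rewrite !mulmxA mul_ginvmx // mul1mx -mulmxA -circM mul_ginvmx //.
  by rewrite circ1 mulmx1.
exists (A *m x *m circ A); first by exists x.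
rewrite !mulmxA mul_ginvmx // mul1mx -mulmxA -circM mul_ginvmx //.
by rewrite circ1 mulmx1.
Qed.

Lemma act_ptKV A : 0 < dnorm A -> cancel (act_pt (ginvmx A)) (@act_pt R Lam A).
Proof.
move=> dA p; apply/seteqP; split=> [z [_ [x px <-] <-]|x px].
  rewrite !mulmxA mulmx_ginv // mul1mx -mulmxA -circM mulmx_ginv //.
  by rewrite circ1 mulmx1.
exists (ginvmx A *m x *m circ (ginvmx A)); first by exists x.
rewrite !mulmxA mulmx_ginv // mul1mx -mulmxA -circM mulmx_ginv //.
by rewrite circ1 mulmx1.
Qed.

Lemma conj_ptK : involutive (@conj_pt R Lam).
Proof.
have mK (x : gmat R Lam) : map_mx (@gconj R Lam) (map_mx (@gconj R Lam) x) = x.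
  by apply/matrixP => i j; rewrite !mxE gconjK.
move=> p; apply/seteqP; split=> [z [_ [x px <-] <-]|x px].
  by rewrite mK.
by exists (map_mx (@gconj R Lam) x); [exists x|rewrite mK].
Qed.

(** What the action, real scalings of either sign and conjugation have in common, in a form closed
    under composition. Null covectors are pushed forward to transport lightlike faces, and the
    induced isometry comes with an inverse because one of two normalizations is undone at the
    end. *)
Record similarity (T : row4R -> row4R) : Prop := Similarity {
  simD : forall u v, T (u + v) = T u + T v;
  simZ : forall a v, T (a *: v) = a *: T v;
  sim_form : exists2 d : R, 0 < d & forall u v,
    bform (T u) (T v) = d * bform u v /\ kform (T u) (T v) = d ^+ 2 * kform u v;
  sim_dual : forall n, n != 0 -> dualq n = 0 ->
    exists n', [/\ n' != 0, dualq n' = 0 & forall v, pr n v = 0 -> pr n' (T v) = 0];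
  sim_inj0 : forall v, T v = 0 -> v = 0;
  sim_isometry : exists f, [/\ XLam_isometry f,
    exists2 g, cancel f g & cancel g f &
    forall v, f (pt (hm v)) = pt (hm (T v))]
}.

Lemma sim_comp S T : similarity S -> similarity T -> similarity (S \o T).
Proof.
move=> [SD SZ [d d0 SB] SQ Si [f [fi [f' ff' f'f] fS]]].
move=> [TD TZ [e e0 TB] TQ Ti [g [gi [g' gg' g'g] gT]]].
split.
- by move=> u v /=; rewrite TD SD.
- by move=> a v /=; rewrite TZ SZ.
- exists (d * e); first exact: mulr_gt0.
  move=> u v /=; case: (SB (T u) (T v)) => -> ->; case: (TB u v) => -> ->.
  by split; ring.
- move=> n /TQ{}TQ /TQ[n' [/SQ{}SQ /SQ[n'' [n0 nQ nn'']] nn']].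
  by exists n''; split=> // v /nn' /nn''.
- by move=> v /Si /Ti.
- exists (f \o g); split; first exact: XLam_isometry_comp.
    by exists (g' \o f'); exact: can_comp.
  by move=> v /=; rewrite gT fS.
Qed.

Lemma pr_neq0 (n : row4R) : n != 0 -> exists v, pr n v != 0.
Proof.
move=> n0; apply: contrapT => h.
have z v : pr n v = 0 by apply: contrapT => e; apply: h; exists v; apply/eqP.
move: n0; rewrite (_ : n = 0) ?eqxx //; apply: row4P; rewrite !cE.
- by have := z (row4 1 0 0 0); rewrite /pr !cE => <-; ring.
- by have := z (row4 0 1 0 0); rewrite /pr !cE => <-; ring.
- by have := z (row4 0 0 1 0); rewrite /pr !cE => <-; ring.
- by have := z (row4 0 0 0 1); rewrite /pr !cE => <-; ring.
Qed.

Lemma pull_neq0 (A : gmat R Lam) n : 0 < dnorm A -> n != 0 -> pull A n != 0 :> row4R.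
Proof.
move=> dA /pr_neq0[v]; rewrite -{1}(TactKV dA v) -pr_pull.
by apply: contraNneq => ->; rewrite /pr !cE !mul0r !addr0.
Qed.

Lemma sim_act (A : gmat R Lam) : 0 < dnorm A -> similarity (Tact A).
Proof.
move=> dA; have dAi := dnorm_ginvmx dA; split.
- exact: TactD.
- exact: TactZ.
- by exists (dnorm A) => // u v; rewrite bform_Tact kform_Tact.
- move=> n n0 nQ; exists (pull (ginvmx A) n); split.
  + exact: pull_neq0.
  + by rewrite dualq_pull nQ mulr0.
  + by move=> v nv; rewrite pr_pull TactK.
- by move=> v e; rewrite -(TactK dA v) e Tact0.
- exists (act_pt A); split.
  + by apply: XLam_isometry_act; apply/in_PGLpP.
  + by exists (act_pt (ginvmx A)); [exact: act_ptK|exact: act_ptKV].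
  + exact: act_pt_hm.
Qed.

Lemma sim_scale a : a != 0 -> similarity ( *:%R a).
Proof.
move=> a0; split.
- by move=> u v; rewrite scalerDr.
- by move=> b v; rewrite !scalerA mulrC.
- exists (a ^+ 2); first by rewrite exprn_even_gt0.
  by move=> u v; rewrite !(bformZl, bformZr, kformZl, kformZr); split; ring.
- by move=> n n0 nQ; exists n; split=> // v; rewrite prZ => ->; rewrite mulr0.
- by move=> v /eqP; rewrite scaler_eq0 (negPf a0) => /eqP.
- exists id; split; first exact: XLam_isometry_id.
    by exists id.
  by move=> v; apply/pt_hmP; exists a.
Qed.

Lemma sim_conj : similarity cconj.
Proof.
have inj0 v : cconj v = 0 -> v = 0.
  move=> e; apply: row4P; rewrite !cE.
  - by have := congr1 (@c0 R) e; rewrite !cE.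
  - by have := congr1 (@c1 R) e; rewrite !cE => /eqP; rewrite oppr_eq0 => /eqP.
  - by have := congr1 (@c2 R) e; rewrite !cE => /eqP; rewrite oppr_eq0 => /eqP.
  - by have := congr1 (@c3 R) e; rewrite !cE => /eqP; rewrite oppr_eq0 => /eqP.
split.
- exact: cconjD.
- exact: cconjZ.
- exists 1; first exact: ltr01.
  by move=> u v; rewrite /kform /bform /iform !cE; split; field.
- move=> n n0 nQ; exists (cconj n); split.
  + by apply: contra_neq n0 => /inj0.
  + by move: nQ; rewrite /dualq !cE => <-; ring.
  + by move=> v; rewrite /pr !cE => <-; ring.
- exact: inj0.
- exists (@conj_pt R Lam); split; first exact: XLam_isometry_conj.
    by exists (@conj_pt R Lam); exact: conj_ptK.
  exact: conj_pt_hm.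
Qed.

End Points.

(** * Geodesics and lightlike planes *)

Section Exponential.
Variables (R : realType) (Lam : int).
Notation L := (Lam%:~R : R).
Notation row4R := 'rV[R]_4.
Notation hm := (@hm R Lam).
Notation e0 := (row4 1 0 0 0 : row4R).

Lemma hm_e0 : hm e0 = 1%:M.
Proof. by rewrite /hm mx22_1 !cE goneE gzeroE oppr0. Qed.

(** Cayley-Hamilton for a traceless matrix, whose determinant is [L * iform v v]. *)
Lemma hm_sqr v : c0 v = 0 -> hm v * hm v = rscale (- (L * iform v v)) 1.
Proof.
move=> v0; have -> : (1 : gmat R Lam) = hm e0 by rewrite hm_e0.
rewrite -hmZ -[_ * _]/(_ *m _) /hm mx22_mul v0 !gE !cE /iform.
by congr mx22; congr GCplx => /=; field.
Qed.

Lemma rscaleMl a (x y : gmat R Lam) : rscale a x * y = rscale a (x * y).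
Proof. by rewrite /rscale -scalerAl. Qed.

Lemma rscaleMr a (x y : gmat R Lam) : x * rscale a y = rscale a (x * y).
Proof. by rewrite /rscale -[_ * _]/(_ *m _) -scalemxAr. Qed.

Variable Lam' : int.
Hypothesis hLam' : Lam' \in [:: -1; 0; 1].

(** The integer [Lam'] = Lam <v, v> plays the part of the curvature along the direction [v]: [v]
    squares to minus [Lam']. Unit spacelike directions have [Lam'] = Lam, unit timelike ones -Lam,
    and lightlike ones 0, where the exponential is affine in t. *)
Lemma exp_term t v k : c0 v = 0 -> L * iform v v = Lam'%:~R ->
  rscale (k`!%:R^-1) (rscale t (hm v) ^+ k) =
  hm (gcos_coeff Lam' t k *: e0 + gsin_coeff Lam' t k *: v).
Proof.
move=> v0 vL.
have p2 j : hm v ^+ j.*2 = rscale ((- Lam'%:~R) ^+ j) 1.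
  rewrite -addnn -[(j + j)%N]addn0; elim: j => [|j IH]; first by rewrite !expr0 rscale1.
  rewrite addn0 addSn addnS exprS exprS -(addn0 (j + j)%N) IH mulrA hm_sqr // vL.
  by rewrite rscaleMl mul1r rscaleA exprS.
have -> : rscale t (hm v) ^+ k = rscale (t ^+ k) (hm v ^+ k).
  elim: k => [|k IH]; first by rewrite !expr0 rscale1.
  by rewrite !exprS IH rscaleMl rscaleMr rscaleA.
rewrite -[X in hm v ^+ X](odd_double_half k) exprD p2 !rscaleMr mulr1 !rscaleA.
rewrite /gcos_coeff /gsin_coeff; case: (odd k) => /=.
  by rewrite expr1 !mul0r scale0r add0r hmZ mul1r; congr rscale; ring.
rewrite expr0 !mul0r scale0r addr0 hmZ hm_e0 mul1r.
by rewrite -[1%:M]/1; congr rscale; ring.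
Qed.

Lemma exp_partial t v n : c0 v = 0 -> L * iform v v = Lam'%:~R ->
  gexpm_partial (rscale t (hm v)) n =
  hm (series (gcos_coeff Lam' t) n *: e0 + series (gsin_coeff Lam' t) n *: v).
Proof.
move=> v0 vL; rewrite /gexpm_partial /series /= !scaler_suml -big_split /=.
by rewrite hm_sum big_mkord; apply: eq_bigr => k _; rewrite exp_term.
Qed.

Lemma gexpm_hm t v : c0 v = 0 -> L * iform v v = Lam'%:~R ->
  gexpm (rscale t (hm v)) = hm (gcos Lam' t *: e0 + gsin Lam' t *: v).
Proof.
move=> v0 vL; rewrite /gexpm.
pose w n := series (gcos_coeff Lam' t) n *: e0 + series (gsin_coeff Lam' t) n *: v.
have -> : gexpm_partial (rscale t (hm v)) = fun n => hm (w n).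
  by apply/funext => n; rewrite exp_partial.
have cvgw a b : (fun n => series (gcos_coeff Lam' t) n * a +
    series (gsin_coeff Lam' t) n * b) @ \oo --> gcos Lam' t * a + gsin Lam' t * b.
  apply: cvgD; apply: cvgM; try exact: cvg_cst.
    exact: cvg_gcos_coeff.
  exact: cvg_gsin_coeff.
have limw a b : limn (fun n => series (gcos_coeff Lam' t) n * a +
    series (gsin_coeff Lam' t) n * b) = gcos Lam' t * a + gsin Lam' t * b.
  exact: cvg_lim.
have lim0 : limn (fun n : nat => 0 : R) = 0 by apply: cvg_lim => //; exact: cvg_cst.
have E0 : limn (fun n => c0 (w n)) = c0 (gcos Lam' t *: e0 + gsin Lam' t *: v).
  by rewrite !cE -limw; congr (limn _); apply/funext => n; rewrite !cE.
have E1 : limn (fun n => c1 (w n)) = c1 (gcos Lam' t *: e0 + gsin Lam' t *: v).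
  by rewrite !cE -limw; congr (limn _); apply/funext => n; rewrite !cE.
have E1' : limn (fun n => - c1 (w n)) = - c1 (gcos Lam' t *: e0 + gsin Lam' t *: v).
  rewrite !cE mulr0 add0r -mulrN -[RHS]add0r -(mulr0 (gcos Lam' t)) -limw.
  by congr (limn _); apply/funext => n; rewrite !cE; ring.
have E2 : limn (fun n => c2 (w n)) = c2 (gcos Lam' t *: e0 + gsin Lam' t *: v).
  by rewrite !cE -limw; congr (limn _); apply/funext => n; rewrite !cE.
have E3 : limn (fun n => c3 (w n)) = c3 (gcos Lam' t *: e0 + gsin Lam' t *: v).
  by rewrite !cE -limw; congr (limn _); apply/funext => n; rewrite !cE.
rewrite [LHS]mx22_eta !mxE /hm /=; congr mx22; congr GCplx => //.
- by apply: etrans E0; congr (limn _); apply/funext => n; rewrite !mxE.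
- by apply: etrans E1; congr (limn _); apply/funext => n; rewrite !mxE.
- by apply: etrans lim0; congr (limn _); apply/funext => n; rewrite !mxE.
- by apply: etrans E2; congr (limn _); apply/funext => n; rewrite !mxE.
- by apply: etrans lim0; congr (limn _); apply/funext => n; rewrite !mxE.
- by apply: etrans E3; congr (limn _); apply/funext => n; rewrite !mxE.
- by apply: etrans E0; congr (limn _); apply/funext => n; rewrite !mxE.
- by apply: etrans E1'; congr (limn _); apply/funext => n; rewrite !mxE.
Qed.

End Exponential.

Section Geodesics.
Variables (R : realType) (Lam : int).
Hypothesis hLam : Lam \in [:: -1; 0; 1].
Notation L := (Lam%:~R : R).
Notation row4R := 'rV[R]_4.
Notation hm := (@hm R Lam).
Notation bform := (@bform R Lam).
Notation e0 := (row4 1 0 0 0 : row4R).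

Lemma in_xLamP (X : gmat R Lam) : in_xLam X -> exists2 v, c0 v = 0 & X = hm v.
Proof.
move=> [/hvK e t0]; exists (hv X); last by rewrite e.
move: t0; rewrite -e /mxtrace !big_ord_recl big_ord0 /hm !mxE /= !gE hmK => -[].
by lra.
Qed.

Lemma in_xLam_hm v : c0 v = 0 -> in_xLam (hm v).
Proof.
move=> v0; split; first exact: circ_hm.
rewrite /mxtrace !big_ord_recl big_ord0 /hm !mxE /= v0 !gE gzeroE.
by congr GCplx => /=; ring.
Qed.

Lemma xform_hm v : xform (hm v) = iform v v.
Proof.
rewrite /xform (_ : map_mx _ _ = mx22 (c1 v) (c2 v) (c3 v) (- c1 v)).
  by rewrite mx22_det /iform; field.
by rewrite [LHS]mx22_eta !mxE.
Qed.

Lemma geodesicE A v (Lam' : int) t : Lam' \in [:: -1; 0; 1] -> c0 v = 0 ->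
  L * iform v v = Lam'%:~R -> geodesic A (hm v) t =
  pt (hm (gcos Lam' t *: Tact A e0 + gsin Lam' t *: Tact A v)).
Proof.
move=> hL v0 vL.
by rewrite /geodesic (gexpm_hm hL) // act_pt_hm TactD !TactZ.
Qed.

Lemma bform_e0 v : bform e0 v = c0 v.
Proof. by rewrite /bform /iform !cE; field. Qed.

Lemma bform_curve v (Lam' : int) t : Lam' \in [:: -1; 0; 1] -> c0 v = 0 ->
  L * iform v v = Lam'%:~R ->
  bform (gcos Lam' t *: e0 + gsin Lam' t *: v) (gcos Lam' t *: e0 + gsin Lam' t *: v) = 1.
Proof.
move=> hL v0 vL; rewrite !(bformDl, bformDr, bformZl, bformZr) (bformC _ v) !bform_e0 !cE v0.
rewrite {1}/bform v0 vL; have := gcos2Dsin2 hL t; lra.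
Qed.

End Geodesics.

(** * Planes as kernels of covectors *)

Section Planes.
Variables (R : realType) (Lam : int).
Hypothesis hLam : Lam \in [:: -1; 0; 1].
Notation L := (Lam%:~R : R).
Notation row4R := 'rV[R]_4.
Notation hm := (@hm R Lam).
Notation bform := (@bform R Lam).
Notation dualq := (@dualq R Lam).
Notation e0 := (row4 1 0 0 0 : row4R).

Lemma prE (n v : row4R) : pr n v = (n *m v^T) 0 0.
Proof.
rewrite mxE !big_ord_recl big_ord0 !mxE addr0 /pr !addrA /c0 /c1 /c2 /c3.
by congr (_ + _ + _ + _); congr (_ * _); congr (_ _ _); apply: val_inj.
Qed.

Lemma mulmx_tr_eq0 (n v : row4R) : pr n v = 0 -> n *m v^T = 0.
Proof. by move=> e; apply/matrixP => i j; rewrite !ord1 -prE e mxE. Qed.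

Lemma hm_mulmx k (a : 'rV[R]_k) (w : 'I_k -> gmat R Lam) :
  (forall i, circ (w i) = w i) ->
  hm (a *m (\matrix_i hv (w i))) = \sum_i rscale (a 0 i) (w i).
Proof.
move=> wH; rewrite mulmx_sum_row hm_sum; apply: eq_bigr => i _.
by rewrite hmZ rowK hvK.
Qed.

Lemma lin_indep_row_free k (w : 'I_k -> gmat R Lam) :
  (forall i, circ (w i) = w i) -> lin_indep w -> row_free (\matrix_i hv (w i)).
Proof.
move=> wH wI; rewrite -kermx_eq0; apply/rowV0P => a /sub_kermxP e.
apply/rowP => i; rewrite mxE; apply: (wI (a 0)).
by rewrite -hm_mulmx // e hm0.
Qed.

Lemma rspanP (w : 'I_3 -> gmat R Lam) :
  (forall i, circ (w i) = w i) -> lin_indep w ->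
  exists2 n : row4R, n != 0 & forall v, rspan w (hm v) <-> pr n v = 0.
Proof.
move=> wH wI; have := lin_indep_row_free wH wI.
set W : 'M[R]_(3, 4) := (X in row_free X) => Wf.
have kW : kermx W^T != 0.
  by rewrite -mxrank_eq0 mxrank_ker mxrank_tr (eqP Wf).
exists (nz_row (kermx W^T)); first by rewrite nz_row_eq0.
have := nz_row_sub (kermx W^T); have : nz_row (kermx W^T) != 0.
  by rewrite nz_row_eq0.
move: (nz_row _) => n n0 /sub_kermxP nW v.
have Wn : W *m n^T = 0 by apply: trmx_inj; rewrite trmx_mul trmxK nW trmx0.
have Wk : (W <= kermx (n^T))%MS by apply/sub_kermxP.
split=> [[a _ e]|/mulmx_tr_eq0 e].
  have -> : v = (\row_i a i) *m W.
    apply: (@hm_inj R Lam); rewrite hm_mulmx // -e.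
    by apply: eq_bigr => i _; rewrite mxE.
  by rewrite prE trmx_mul mulmxA nW mul0mx mxE.
(* Both subspaces have rank 3, so the inclusion [Wk] is an equality. *)
have : (kermx (n^T) <= W)%MS.
  rewrite -(mxrank_leqif_sup Wk) mxrank_ker mxrank_tr (eqP Wf).
  by rewrite rank_rV n0.
have vk : (v <= kermx (n^T))%MS.
  by apply/sub_kermxP; apply: trmx_inj; rewrite trmx_mul trmxK e trmx0.
move=> /(submx_trans vk) /submxP[D ->].
by exists (D 0) => //; rewrite hm_mulmx.
Qed.

Lemma geodesic_planeP P : geodesic_plane P -> exists2 n : row4R, n != 0 &
  forall v, P (pt (hm v)) <-> 0 < bform v v /\ pr n v = 0.
Proof.
move=> [w [wH wI ->]]; have [n n0 nP] := rspanP wH wI; exists n => // v; split.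
  move=> [[x /representsP[xe x0] xv] [y yw yv]].
  split.
    move: xv; rewrite -xe => /pt_hmP[a a0 ->].
    by rewrite bformZl bformZr mulrA -expr2 pmulr_rgt0 // exprn_even_gt0.
  have yH : circ y = y.
    case: yw => b _ <-; rewrite /circ.
    have -> : \sum_i rscale (b i) (w i) = hm ((\row_i b i) *m \matrix_i hv (w i)).
      by rewrite hm_mulmx //; apply: eq_bigr => i _; rewrite mxE.
    exact: circ_hm.
  move: yw yv; rewrite -(hvK yH) => /nP yn /pt_hmP[b b0 ->].
  by rewrite prZ yn mulr0.
move=> [v0 vn]; split; first by exists (hm v) => //; apply/represents_hm.
by exists (hm v) => //; apply/nP.
Qed.

(* A null vector orthogonal to a non-null [N] forces [N] to be spacelike, and
   then the complement of [N] also contains a timelike vector. *)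
Lemma timelike_in_complement (N X : row4R) : c0 X = 0 -> X != 0 -> iform X X = 0 ->
  iform N X = 0 -> iform N N != 0 ->
  exists Z, [/\ c0 Z = 0, iform Z Z = -1 & iform N Z = 0].
Proof.
move=> X0 Xn XX NX NN.
have NNp : 0 < iform N N.
  rewrite lt_neqAle eq_sym NN /=; rewrite leNgt; apply/negP => NNn.
  move: Xn; rewrite (_ : X = 0) ?eqxx //.
  move: XX NX NNn; rewrite /iform.
  set n := c1 N; set m := c2 N; set p := c3 N.
  move=> XX NX NNn.
  have e1 : c1 X ^+ 2 = - (c2 X * c3 X) by lra.
  have e2 : n * c1 X = - (m * c3 X + p * c2 X) / 2 by lra.
  have d0 : n ^+ 2 + m * p < 0 by lra.
  (* The left side is at most 0 by [d0] and the right side at least 0, so both vanish; this forces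
     all coordinates of [X] to be 0. *)
  have e3 : (n ^+ 2 + m * p) * c1 X ^+ 2 = (m * c3 X - p * c2 X) ^+ 2 / 4.
    by rewrite mulrDl -exprMn e2 e1; field.
  have q0 : c1 X = 0.
    apply/eqP; rewrite -sqrf_eq0 eq_le sqr_ge0 andbT.
    rewrite -(nmulr_rge0 _ d0) e3; apply: divr_ge0; rewrite ?sqr_ge0 //.
  have bc : c2 X * c3 X = 0 by rewrite q0 in e1; lra.
  have mp : m * p < 0 by have := sqr_ge0 n; lra.
  have [m0 p0] : m != 0 /\ p != 0.
    by split; apply/eqP => z; move: mp; rewrite z ?mul0r ?mulr0 ltxx.
  have s0 : m * c3 X + p * c2 X = 0 by rewrite q0 in e2; lra.
  apply: row4P; rewrite !cE //.
    have : p * c2 X ^+ 2 = c2 X * (m * c3 X + p * c2 X) - m * (c2 X * c3 X) by ring.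
    by rewrite s0 bc !mulr0 subr0 => /eqP; rewrite mulf_eq0 (negPf p0) sqrf_eq0 => /eqP.
  have : m * c3 X ^+ 2 = c3 X * (m * c3 X + p * c2 X) - p * (c2 X * c3 X) by ring.
  by rewrite s0 bc !mulr0 subr0 => /eqP; rewrite mulf_eq0 (negPf m0) sqrf_eq0 => /eqP.
(* [T] is timelike, and [Z] is its component orthogonal to [N], cleared of the denominator
   [iform N N]. *)
pose T : row4R := row4 0 0 1 (-1).
pose Z : row4R := row4 0 (- iform N T * c1 N) (iform N N - iform N T * c2 N)
  (- iform N N - iform N T * c3 N).
have ZZ : iform Z Z = - (iform N N * (iform N N + iform N T ^+ 2)).
  by rewrite /Z /T /iform !cE; field.
have k0 : 0 < iform N N * (iform N N + iform N T ^+ 2).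
  by rewrite mulr_gt0 // ltr_wpDr ?sqr_ge0.
set k := iform N N * _ in ZZ k0.
exists ((Num.sqrt k)^-1 *: Z); split.
- by rewrite !cE mulr0.
- by rewrite iformZl iformZr mulrA -expr2 exprVn sqr_sqrtr ?ltW // ZZ mulrN mulVf // gt_eqF.
- by rewrite iformZr (_ : iform N Z = 0) ?mulr0 // /Z /T /iform !cE; field.
Qed.

(** Pull the plane back along A so that it contains 1; its covector [m] then only sees imaginary
    directions. If [m] were not null, the given lightlike direction would produce a timelike one in
    the same plane, hence a forbidden timelike geodesic. *)
Lemma lightlike_planeP P : lightlike_plane P -> exists n : row4R,
  [/\ n != 0, dualq n = 0 & forall v, P (pt (hm v)) <-> 0 < bform v v /\ pr n v = 0].
Proof.
move=> [/geodesic_planeP[n n0 nP] [c [A [X [/in_PGLpP dA Xx XN X0 ->]]] cP] nt].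
exists n; split=> //.
have [v v0 eX] := in_xLamP Xx; subst X; rewrite xform_hm in X0.
have vN : v != 0 by apply/eqP => e; apply: XN; rewrite e hm0.
have on t : pr n (Tact A e0) + t * pr n (Tact A v) = 0.
  have := cP t; rewrite (@geodesicE _ _ _ _ 0) ?X0 ?mulr0 // => /nP[_].
  by rewrite /gcos /gsin /= prD !prZ mul1r.
have ne : pr n (Tact A e0) = 0 by have := on 0; rewrite mul0r addr0.
have nv : pr n (Tact A v) = 0 by have := on 1; rewrite ne add0r mul1r.
move: ne nv; rewrite -!pr_pull; set m := pull A n => me mv.
have m00 : c0 m = 0 by move: me; rewrite /pr !cE; lra.
apply/eqP; apply: contraT => Qn.
have Qm : dualq m != 0 by rewrite dualq_pull mulf_neq0 // gt_eqF.
(* The vector representing [m] through [iform]; the exchange and the factors 2 come from the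
   off-diagonal halves of that form. *)
pose N : row4R := row4 0 (c1 m) (2 * c3 m) (2 * c2 m).
have prN w : c0 w = 0 -> pr m w = iform N w.
  by move=> w0; rewrite /pr /iform /N w0 !cE; field.
have NN : iform N N = dualq m by rewrite /dualq m00 /iform /N !cE; field.
have [||Z [Z0 ZZ NZ]] := timelike_in_complement v0 vN X0 (N := N).
- by rewrite -prN.
- by rewrite NN.
have hL : - Lam \in [:: -1; 0; 1] by case: (LamP hLam) => ->.
have LZ : L * iform Z Z = (- Lam)%:~R by rewrite ZZ mulrN1 mulrNz.
case: nt; exists (geodesic A (hm Z)).
  exists A, (hm Z); split=> //.
  - exact/in_PGLpP.
  - exact: in_xLam_hm.
  - move=> e; have := xform_hm Lam Z; rewrite e /xform ZZ.
    rewrite (_ : map_mx _ 0 = 0) ?det0 ?oppr0; last first.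
      by apply/matrixP => i j; rewrite !mxE.
    by move/eqP; rewrite eq_sym oppr_eq0 oner_eq0.
  - by rewrite xform_hm ZZ ltrN10.
move=> t; rewrite (geodesicE _ _ hL) // -!TactZ -TactD.
apply/nP; split.
  by rewrite bform_Tact (bform_curve _ hL) // mulr1.
by rewrite -pr_pull prD !prZ me prN // NZ !mulr0 addr0.
Qed.

End Planes.

(** * Edges of tetrahedra *)

Section Edges.
Variables (R : realType) (Lam : int).
Hypothesis hLam : Lam \in [:: -1; 0; 1].
Notation L := (Lam%:~R : R).
Notation row4R := 'rV[R]_4.
Notation hm := (@hm R Lam).
Notation bform := (@bform R Lam).
Notation kform := (@kform R Lam).
Notation dualq := (@dualq R Lam).
Notation e0 := (row4 1 0 0 0 : row4R).
Notation gcos := (@gcos R Lam).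
Notation gsin := (@gsin R Lam).

(* With [u], [v] of determinant 1: [bform u v = c(r)] and [kform u v = s(r)^2]; the first
   determines the second unless [Lam = 0], when it is void up to sign. *)
Definition edge_rel (u v : row4R) (r : R) : Prop :=
  [/\ 0 < r, Lam = 1 -> r < pi & exists2 m, 0 < m &
    [/\ m ^+ 2 = bform u u * bform v v, bform u v = gcos r * m
      & kform u v = gsin r ^+ 2 * m ^+ 2]].

Lemma edge_relC u v r : edge_rel u v r -> edge_rel v u r.
Proof.
move=> [r0 rpi [m m0 [e1 e2 e3]]]; split=> //; exists m => //.
by rewrite bformC kformC; split=> //; rewrite mulrC.
Qed.

Lemma edge_rel_sim T u v r : similarity Lam T -> edge_rel u v r -> edge_rel (T u) (T v) r.
Proof.
move=> sT [r0 rpi [m m0 [e1 e2 e3]]]; split=> //.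
have [d d0 dT] := sim_form sT; exists (d * m); first exact: mulr_gt0.
rewrite (dT u v).1 (dT u v).2 (dT u u).1 (dT v v).1 e2 e3 exprMn e1.
by split; ring.
Qed.

Lemma edge_relZ a b u v r : 0 < a -> 0 < b ->
  edge_rel u v r -> edge_rel (a *: u) (b *: v) r.
Proof.
move=> a0 b0 [r0 rpi [m m0 [e1 e2 e3]]]; split=> //.
exists (a * b * m); first by rewrite !mulr_gt0.
by rewrite !(bformZl, bformZr, kformZl, kformZr) e2 e3 !exprMn e1; split; ring.
Qed.

Lemma edge_rel_inj u v r s : 0 < bform u u -> 0 < bform v v ->
  edge_rel u v r -> edge_rel u v s -> r = s.
Proof.
move=> u0 v0 [r0 rpi [m m0 [e1 e2 e3]]] [s0 spi [k k0 [f1 f2 f3]]].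
have mk : k = m.
  by apply/eqP; rewrite -(eqrXn2 (n := 2)) ?ltW // f1 e1.
subst k; have mn : m != 0 by rewrite gt_eqF.
apply: (gcos_gsin_inj hLam) => //; first by apply: (mulIf mn); rewrite -e2.
apply/eqP; rewrite -(eqrXn2 (n := 2)) ?ltW ?(gsin_gt0 hLam) //.
by apply/eqP/(mulIf (expf_neq0 2 mn)); rewrite -e3.
Qed.

Section Tetrahedron.
Variable x : 'I_4 -> gmat R Lam.
Hypothesis x_indep : lin_indep x.
Hypothesis x_cone : forall z, subcone x [set: 'I_4]%SET z -> represents z.
Notation u := (fun i => hv (x i)).

Lemma vertex_represents i : represents (x i).
Proof.
apply: x_cone; exists (fun j => (j == i)%:R); last first.
  rewrite (bigD1 i) ?inE //= eqxx rscale1 big1 ?addr0 // => j /andP[_ /negPf ->].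
  by rewrite /rscale /greal -gzeroE scale0r.
split=> [j|]; first exact: ler0n.
rewrite (bigD1 i) ?inE //= eqxx big1 ?addr0 ?oner_neq0 // => j /andP[_ /negPf ->].
by [].
Qed.

Lemma vertexE i : hm (u i) = x i.
Proof. by have [] := representsP (vertex_represents i). Qed.

Lemma vertex_pos i : 0 < bform (u i) (u i).
Proof. by have [] := representsP (vertex_represents i). Qed.

Lemma rscale_vertices (S : {set 'I_4}) (a : 'I_4 -> R) :
  \sum_(i in S) rscale (a i) (x i) = hm (\sum_(i in S) a i *: u i).
Proof. by rewrite hm_sum; apply: eq_bigr => i _; rewrite hmZ vertexE. Qed.

Lemma vertex_indep (a : 'I_4 -> R) : \sum_i a i *: u i = 0 -> forall i, a i = 0.
Proof.
move=> e; apply: x_indep.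
have := rscale_vertices [set: 'I_4]%SET a.
rewrite (eq_bigl xpredT) => [->|i]; last by rewrite inE.
by rewrite (eq_bigl xpredT) => [|i]; rewrite ?inE // e hm0.
Qed.

Lemma sum_two (V : lmodType R) (i j : 'I_4) (w : 'I_4 -> V) (a b : R) : i != j ->
  \sum_k (if k == i then a else if k == j then b else 0) *: w k =
  a *: w i + b *: w j.
Proof.
move=> ij; have ji : j != i by rewrite eq_sym.
rewrite (bigD1 i) //= eqxx (bigD1 j) //= (negPf ji) eqxx big1 ?addr0 // => k.
by move=> /andP[/negPf -> /negPf ->]; rewrite scale0r.
Qed.

Lemma vertex_indep2 i j (a b : R) : i != j ->
  a *: u i + b *: u j = 0 -> a = 0 /\ b = 0.
Proof.
move=> ij; rewrite -(sum_two u) // => /vertex_indep e.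
by have := e i; have := e j; rewrite !eqxx [j == i]eq_sym (negPf ij).
Qed.

Lemma edgeP i j (p : gpoint R Lam) : i != j -> edge x i j p <->
  exists a b, [/\ 0 <= a, 0 <= b, a + b != 0 & p = pt (hm (a *: u i + b *: u j))].
Proof.
move=> ij; have ji : j != i by rewrite eq_sym.
have ij' : i \notin [set j]%SET by rewrite inE.
rewrite /edge /simplex; split.
  move=> [z [a [a0 s0] <-] <-]; exists (a i), (a j); split=> //.
    by move: s0; rewrite big_setU1 // big_set1.
  by rewrite rscale_vertices big_setU1 // big_set1.
move=> [a [b [a0 b0 s0 ->]]].
exists (hm (a *: u i + b *: u j)) => //.
exists (fun k => if k == i then a else b).
  split; first by move=> k; case: ifP.
  by rewrite big_setU1 // big_set1 eqxx (negPf ji).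
by rewrite rscale_vertices big_setU1 // big_set1 eqxx (negPf ji).
Qed.

Hypothesis x_face : forall i, exists2 P, lightlike_plane P & simplex x [set~ i]%SET `<=` P.

(** The plane is kept next to its covector because the exclusion of timelike edges refers to its
    geodesics. *)
Lemma face_covector k : exists P n, [/\ lightlike_plane P, n != 0, dualq n = 0,
  (forall v, P (pt (hm v)) <-> 0 < bform v v /\ pr n v = 0)
  & forall i, i != k -> pr n (u i) = 0].
Proof.
have [P Pl sP] := x_face k; have [n [n0 nQ nP]] := lightlike_planeP hLam Pl.
exists P, n; split=> // i ik; have [] := (nP (u i)).1 => //.
apply: sP; exists (hm (u i)) => //; exists (fun j => (j == i)%:R).
  split=> [j|]; first exact: ler0n.
  rewrite (bigD1 i) ?inE //= eqxx big1 ?addr0 ?oner_neq0 // => j /andP[_ /negPf ->].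
  by [].
rewrite rscale_vertices (bigD1 i) ?inE //= eqxx scale1r big1 ?addr0 //.
by move=> j /andP[_ /negPf ->]; rewrite scale0r.
Qed.

(** Used to place the edge from i to j in a lightlike face, the one opposite to k. *)
Lemma third_index (i j : 'I_4) : exists2 k, i != k & j != k.
Proof.
have : ~~ ([set: 'I_4] \subset [set i; j])%SET.
  apply/negP => /subset_leq_card; rewrite cardsT card_ord cards2.
  by case: (i != j).
by case/subsetPn => k _; rewrite !inE negb_or !(eq_sym k) => /andP[]; exists k.
Qed.

(** Only a relation between the two vectors is wanted, yet [edge_length] speaks of projective
    points. The unknown scalars [a], [b] enter the relation through their product, whose sign is the
    delicate point. *)
Lemma edge_length_rel i j r : i != j -> edge_length x i j r ->
  edge_rel (u i) (u j) r.
Proof.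
move=> ij [r0 [c [[A [X [dA Xx XN X1 ec]]] ci cj [cin cinj _]]]].
have [v v0 eX] := in_xLamP Xx; subst X; move: X1; rewrite xform_hm => X1.
move/in_PGLpP in dA.
have L01 : exists2 Lam' : int, Lam' \in [:: -1; 0; 1] & L * iform v v = Lam'%:~R.
  have [v1|v1] : iform v v = 1 \/ iform v v = -1.
  - by move: X1; case: (ler0P (iform v v)) => _ e; [right|left]; lra.
  - by exists Lam; rewrite // v1 mulr1.
  - by exists (- Lam); [case: (LamP hLam) => ->|rewrite v1 mulrN1 mulrNz].
have [Lam' hL' vL] := L01.
have ceq t := geodesicE A t hL' v0 vL.
move: ci; rewrite -vertexE ec ceq (gcos0 _ hL') (gsin0 _ hL') scale0r scale1r addr0.
move=> /pt_hmP[a a0 ui].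
move: (cj); rewrite -vertexE ec ceq => /pt_hmP[b b0 uj].
have indep (s t : R) : s *: u i + t *: u j = 0 -> s = 0 /\ t = 0.
  exact: vertex_indep2.
have Sr : Defs.gsin Lam' r != 0.
  apply/eqP => S0; move: uj; rewrite S0 scale0r addr0 => uj.
  have /indep[_] : (b * Defs.gcos Lam' r) *: u i + (- a) *: u j = 0.
    by rewrite ui uj !scalerA -scalerDl (_ : _ + _ = 0) ?scale0r //; ring.
  by move/eqP; rewrite oppr_eq0 (negPf a0).
(* A timelike edge would give a timelike geodesic inside a lightlike face, since the whole geodesic
   lies in the span of its two vertices. *)
have vv : iform v v = 1.
  move: X1; case: (ler0P (iform v v)) => // vn X1; exfalso.
  have [k ik jk] := third_index i j.
  have [P [n [[_ _ nt] n0 nQ nP nu]]] := face_covector k.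
  have ne : pr n (Tact A e0) = 0.
    have := nu i ik; rewrite ui prZ => /eqP.
    by rewrite mulf_eq0 (negPf a0) => /eqP.
  have nv : pr n (Tact A v) = 0.
    have := nu j jk; rewrite uj prZ prD !prZ ne mulr0 add0r => /eqP.
    by rewrite !mulf_eq0 (negPf b0) (negPf Sr) => /eqP.
  apply: nt; exists c.
    exists A, (hm v); split=> //; first exact/in_PGLpP.
    by rewrite xform_hm; lra.
  move=> t; rewrite ec ceq; apply/nP; split; last by rewrite prD !prZ ne nv; ring.
  by rewrite -!TactZ -TactD bform_Tact (bform_curve _ hL') // mulr1.
have eL : Lam' = Lam.
  by apply: (@intr_inj R); rewrite -vL vv mulr1.
subst Lam'.
have rp : 0 < r.
  rewrite lt_neqAle r0 andbT; apply: contra_neq Sr => <-.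
  exact: gsin0.
(* In de Sitter space a spacelike geodesic closes up projectively after pi, so a longer arc would
   not be injective. *)
have rpi : Lam = 1 -> r < pi.
  move=> e1; rewrite ltNge; apply/negP => pir.
  have := cinj 0 pi; rewrite !inE /= lexx r0 pi_ge0 pir ec !ceq.
  have cpi : gcos pi = -1 by rewrite /Defs.gcos e1 /= cospi.
  have spi : gsin pi = 0 by rewrite /Defs.gsin e1 /= sinpi.
  rewrite (gcos0 _ hLam) (gsin0 _ hLam) cpi spi.
  rewrite !scale0r !addr0 scale1r scaleN1r => /(_ isT isT).
  have -> : pt (hm (Tact A e0)) = pt (hm (- Tact A e0)).
    by apply/pt_hmP; exists (-1); rewrite ?scaleN1r // oppr_eq0 oner_eq0.
  by move/(_ erefl) => p0; have := pi_gt0 R; rewrite -p0 ltxx.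
have S0 : 0 < gsin r by exact: gsin_gt0.
have Sh : 0 < gsin (r / 2).
  by apply: gsin_gt0 => // [|/rpi]; lra.
(* With respect to the two vertices, the midpoint [c (r / 2)] has coefficients proportional to 1/a
   and 1/b. It lies on the edge, so these have the same sign. *)
have ab : 0 < a * b.
  have : edge x i j (c (r / 2)) by apply: cin; rewrite /=; lra.
  move=> /(edgeP _ ij)[s [t [s0 t0 _]]]; rewrite ec ceq => /pt_hmP[k k0].
  have tv : Tact A v = (gsin r)^-1 *: (b^-1 *: u j - (gcos r / a) *: u i).
    by apply/rowP => l; rewrite uj ui !mxE; field; rewrite a0 b0 Sr.
  have te : Tact A e0 = a^-1 *: u i by rewrite ui scalerA mulVf // scale1r.
  move=> e.
  have /indep[e1 e2] :
      (s - k * (gcos (r / 2) / a - gsin (r / 2) * gcos r / gsin r / a)) *: u i +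
      (t - k * (gsin (r / 2) / gsin r / b)) *: u j = 0.
    move/eqP: e; rewrite -subr_eq0 te tv => /eqP e; rewrite -[RHS]e.
    by apply/rowP => l; rewrite !mxE; field; rewrite ?a0 ?b0 ?Sr.
  have es : s = k * gsin (r / 2) / gsin r / a.
    have -> : s = k * (gcos (r / 2) / a - gsin (r / 2) * gcos r / gsin r / a) by lra.
    have : gsin (r - r / 2) = gsin r * gcos (r / 2) - gcos r * gsin (r / 2).
      exact: gsinB.
    rewrite (_ : r - r / 2 = r / 2); last by lra.
    by move=> {2}->; field; rewrite ?a0 ?Sr.
  have et : t = k * gsin (r / 2) / gsin r / b by lra.
  have st : 0 <= s * t by exact: mulr_ge0.
  have : s * t = (k * gsin (r / 2) / gsin r / (a * b)) ^+ 2 * (a * b).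
    by rewrite es et; field; rewrite ?a0 ?b0 ?Sr.
  move=> e'; rewrite e' pmulr_rge0 in st.
    by rewrite lt_neqAle st andbT eq_sym mulf_neq0.
  have Sh0 : gsin (r / 2) != 0 by rewrite gt_eqF.
  by rewrite exprn_even_gt0 //= !mulf_neq0 ?invr_neq0 ?mulf_neq0.
split=> //; exists (a * b * dnorm A); first by rewrite mulr_gt0.
have Be w : bform e0 w = c0 w by exact: bform_e0.
have Ie w : iform e0 w = 0 by rewrite /iform !cE; field.
rewrite !hmK ui uj -!TactZ -!TactD !(bform_Tact, kform_Tact, bformZl, bformZr, kformZl, kformZr).
have Bvv : bform (gcos r *: e0 + gsin r *: v) (gcos r *: e0 + gsin r *: v) = 1.
  exact: bform_curve.
rewrite Bvv kformDr kformZr !Be !cE v0; split; try ring.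
rewrite /kform vv !Ie !cE; ring.
Qed.

End Tetrahedron.
End Edges.

(** * Classification of lightlike tetrahedra *)

Section Tetrahedra.
Variables (R : realType) (Lam : int).
Hypothesis hLam : Lam \in [:: -1; 0; 1].
Notation row4R := 'rV[R]_4.
Notation hm := (@hm R Lam).
Notation bform := (@bform R Lam).
Notation dualq := (@dualq R Lam).
Notation e0 := (row4 1 0 0 0 : row4R).
Notation gcos := (@gcos R Lam).
Notation gsin := (@gsin R Lam).
Notation similarity := (@similarity R Lam).
Notation edge_rel := (@edge_rel R Lam).
Implicit Types (u : 'I_4 -> row4R) (rho : 'I_4 -> 'I_4 -> R).

(** The linear content of a lightlike tetrahedron with its lengths, stable under similarities,
    positive rescaling of single vertices and permutations. *)
Record tetra u rho : Prop := Tetra {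
  tetra_indep : forall a : 'I_4 -> R, \sum_i a i *: u i = 0 -> forall i, a i = 0;
  tetra_cone : forall a : 'I_4 -> R, (forall i, 0 <= a i) -> \sum_i a i != 0 ->
    0 < bform (\sum_i a i *: u i) (\sum_i a i *: u i);
  tetra_face : forall k, exists n,
    [/\ n != 0, dualq n = 0 & forall i, i != k -> pr n (u i) = 0];
  tetra_edge : forall i j, i != j -> edge_rel (u i) (u j) (rho i j)
}.

Definition tetra_set u : set (gpoint R Lam) :=
  [set p | exists a : 'I_4 -> R, [/\ forall i, 0 <= a i, \sum_i a i != 0
     & p = pt (hm (\sum_i a i *: u i))]].

Lemma sim_sum T (I : Type) (r : seq I) (P : pred I) (a : I -> R) (w : I -> row4R) :
  similarity T ->
  T (\sum_(i <- r | P i) a i *: w i) = \sum_(i <- r | P i) a i *: T (w i).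
Proof.
move=> sT; have T0 : T 0 = 0 by rewrite -[X in T X](scale0r (0 : row4R)) (simZ sT) scale0r.
rewrite (big_morph T (simD sT) T0).
by apply: eq_bigr => i _; rewrite (simZ sT).
Qed.

Lemma tetra_sim T u rho : similarity T -> tetra u rho -> tetra (T \o u) rho.
Proof.
move=> sT [ui uc uf ue]; have [d d0 dT] := sim_form sT; split.
- by move=> a; rewrite -(sim_sum _ _ _ _ sT) => /(sim_inj0 sT)/ui.
- move=> a a0 s0; rewrite -(sim_sum _ _ _ _ sT) (dT _ _).1.
  by apply: mulr_gt0 => //; exact: uc.
- move=> k; have [n [n0 nQ nu]] := uf k.
  have [n' [n'0 n'Q n'u]] := sim_dual sT n0 nQ.
  by exists n'; split=> // i /nu /n'u.
- by move=> i j /ue; exact: edge_rel_sim.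
Qed.

Lemma tetra_set_sim T u f : similarity T -> (forall v, f (pt (hm v)) = pt (hm (T v))) ->
  f @` tetra_set u = tetra_set (T \o u).
Proof.
move=> sT fT; apply/seteqP; split=> [p [_ [a [a0 s0 ->]] <-]|p [a [a0 s0 ->]]].
  by exists a; split=> //; rewrite fT (sim_sum _ _ _ _ sT).
exists (pt (hm (\sum_i a i *: u i))); first by exists a.
by rewrite fT (sim_sum _ _ _ _ sT).
Qed.

Lemma sum_neq0_ge0 (a : 'I_4 -> R) : (forall i, 0 <= a i) ->
  (\sum_i a i != 0) <-> exists i, a i != 0.
Proof.
move=> a0; split=> [|[i ai]].
  rewrite psumr_neq0 // => /hasP[i _ /andP[_ ai]].
  by exists i; rewrite gt_eqF.
rewrite psumr_neq0 //; apply/hasP; exists i; first exact: mem_index_enum.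
by rewrite /= lt_neqAle eq_sym ai a0.
Qed.

Lemma tetra_scale (m : 'I_4 -> R) u rho : (forall i, 0 < m i) -> tetra u rho ->
  tetra (fun i => m i *: u i) rho.
Proof.
move=> m0 [ui uc uf ue]; split.
- move=> a; rewrite (eq_bigr (fun i => (a i * m i) *: u i)) => [/ui e i|i _].
    by apply/(mulIf (_ : m i != 0)); rewrite ?gt_eqF // mul0r e.
  by rewrite scalerA.
- move=> a a0 /(sum_neq0_ge0 a0)[i ai].
  rewrite (eq_bigr (fun i => (a i * m i) *: u i)) => [|j _]; last by rewrite scalerA.
  have am j : 0 <= a j * m j by rewrite mulr_ge0 // ltW.
  apply: uc => //; apply/(sum_neq0_ge0 am); exists i.
  by rewrite mulf_neq0 // gt_eqF.
- move=> k; have [n [n0 nQ nu]] := uf k; exists n; split=> // i /nu.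
  by rewrite prZ => ->; rewrite mulr0.
- by move=> i j /ue; exact: edge_relZ.
Qed.

Lemma tetra_set_scale (m : 'I_4 -> R) u : (forall i, 0 < m i) ->
  tetra_set (fun i => m i *: u i) = tetra_set u.
Proof.
move=> m0; apply/seteqP; split=> p [a [a0 /(sum_neq0_ge0 a0)[i ai] ->]].
  have am j : 0 <= a j * m j by rewrite mulr_ge0 // ltW.
  exists (fun i => a i * m i); split=> //.
    by apply/(sum_neq0_ge0 am); exists i; rewrite mulf_neq0 // gt_eqF.
  by congr (pt (hm _)); apply: eq_bigr => j _; rewrite scalerA.
have am j : 0 <= a j / m j by rewrite divr_ge0 // ltW.
exists (fun i => a i / m i); split=> //.
  by apply/(sum_neq0_ge0 am); exists i; rewrite mulf_neq0 ?invr_neq0 // gt_eqF.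
by congr (pt (hm _)); apply: eq_bigr => j _; rewrite scalerA divfK // gt_eqF.
Qed.

Lemma sum_perm (V : nmodType) (s : {perm 'I_4}) (F : 'I_4 -> V) : \sum_i F (s i) = \sum_i F i.
Proof. by rewrite [RHS](reindex_inj (@perm_inj _ s)). Qed.

Lemma tetra_perm (s : {perm 'I_4}) u rho : tetra u rho ->
  tetra (u \o s) (fun i j => rho (s i) (s j)).
Proof.
move=> [ui uc uf ue].
have sE (a : 'I_4 -> R) : \sum_i a i *: (u \o s) i = \sum_i a (s^-1%g i) *: u i.
  by rewrite -(sum_perm s (fun i => a ((s^-1)%g i) *: u i)); apply: eq_bigr => i _; rewrite permK.
split.
- by move=> a; rewrite sE => /ui e i; rewrite -(permK s i) e.
- move=> a a0 s0; rewrite sE; apply: uc => [i //|].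
  by rewrite (sum_perm (s^-1)%g).
- move=> k; have [n [n0 nQ nu]] := uf (s k); exists n; split=> // i ik.
  by apply: nu; rewrite (inj_eq perm_inj).
- by move=> i j ij; apply: ue; rewrite (inj_eq perm_inj).
Qed.

Lemma tetra_set_perm (s : {perm 'I_4}) u : tetra_set (u \o s) = tetra_set u.
Proof.
have sE (a : 'I_4 -> R) : \sum_i a (s i) *: u (s i) = \sum_i a i *: u i.
  by rewrite (sum_perm s (fun i => a i *: u i)).
apply/seteqP; split=> p [a [a0 s0 ->]].
  exists (a \o (s^-1)%g); split=> [i||]; first exact: a0.
    by rewrite (sum_perm (s^-1)%g).
  by rewrite -sE; congr (pt (hm _)); apply: eq_bigr => i _ /=; rewrite permK.
exists (a \o s); split=> [i||]; first exact: a0.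
  by rewrite (sum_perm s).
by rewrite -sE.
Qed.

Lemma tetra_pos u rho i : tetra u rho -> 0 < bform (u i) (u i).
Proof.
move=> [_ uc _ _]; have := uc (fun j => (j == i)%:R).
rewrite (bigD1 i) //= eqxx big1 => [|j /negPf -> //].
rewrite addr0 oner_neq0 (bigD1 i) //= eqxx scale1r big1 ?addr0 => [|j /negPf ->].
  by apply=> // j; exact: ler0n.
by rewrite scale0r.
Qed.

Lemma tetra_sym u rho i j : tetra u rho -> i != j -> rho i j = rho j i.
Proof.
move=> ut ij; apply: (edge_rel_inj hLam) (tetra_edge ut ij) _.
- exact: tetra_pos ut.
- exact: tetra_pos ut.
- by apply: edge_relC; apply: (tetra_edge ut); rewrite eq_sym.
Qed.

Lemma tetra_span u rho n : tetra u rho -> (forall i, pr n (u i) = 0) -> n = 0.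
Proof.
move=> ut nu; set U : 'M[R]_4 := \matrix_i u i.
have Uu : U \in unitmx.
  rewrite -row_free_unit -kermx_eq0; apply/rowV0P => a /sub_kermxP e.
  apply/rowP => i; rewrite mxE; apply: (tetra_indep ut).
  rewrite -[RHS]e mulmx_sum_row; apply: eq_bigr => j _.
  by rewrite rowK.
have e : U *m n^T = 0.
  apply/matrixP => i j; rewrite !ord1 mxE [RHS]mxE -[RHS](nu i) prE mxE.
  by apply: eq_bigr => k _; rewrite !mxE mulrC.
by apply: trmx_inj; rewrite -(mulKmx Uu n^T) e mulmx0 trmx0.
Qed.

Definition std_rows (a b : R) : 'I_4 -> row4R := fun i => nth 0
  [:: row4 (gcos a) (gsin a) (- (2 * gsin a)) 0;
      row4 (gcos b) (gsin b) 0 (2 * gsin b);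
      row4 (gcos (a + b)) (gsin (a + b)) 0 0; e0] i.

(** The condition [a <= b] makes the pair a function of the multiset of lengths. *)
Definition standardizable u rho : Prop := exists a b : R,
  [/\ 0 < a, a <= b,
      perm_eq (edge_seq rho) [:: a; a; b; b; a + b; a + b]
    & exists f, [/\ XLam_isometry f, exists2 g, cancel f g & cancel g f
        & f @` tetra_set u = tetra_set (std_rows a b)]].

Lemma standardizable_sim T u rho : similarity T ->
  standardizable (T \o u) rho -> standardizable u rho.
Proof.
move=> sT [a [b [a0 ab e [f [fi [g fg gf] fu]]]]].
have [h [hi [k hk kh] hT]] := sim_isometry sT.
exists a, b; split=> //; exists (f \o h); split.
- exact: XLam_isometry_comp.
- by exists (k \o g); exact: can_comp.
- by rewrite -image_comp (tetra_set_sim u sT hT).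
Qed.

Lemma edge_seq_tperm (i j : 'I_4) rho : i \in [:: 0; 1] -> j \in [:: 1; 2] ->
  (forall k l, k != l -> rho k l = rho l k) ->
  perm_eq (edge_seq rho) (edge_seq (fun k l => rho (tperm i j k) (tperm i j l))).
Proof.
rewrite !inE => /orP[] /eqP -> /orP[] /eqP -> sym; rewrite /edge_seq.
- rewrite tpermL tpermR !tpermD // (sym 1 0) //.
  (* Counting the elements satisfying [p] turns a permutation of explicit lists into an identity of
     sums. *)
  by apply/seq.permP => p /=; ring.
- rewrite tpermL tpermR !tpermD // (sym 2 0) // (sym 2 1) // (sym 1 0) //.
  by apply/seq.permP => p /=; ring.
- by rewrite tperm1 !perm1.
- rewrite tpermL tpermR !tpermD // (sym 2 1) //.
  by apply/seq.permP => p /=; ring.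
Qed.

Lemma standardizable_tperm (i j : 'I_4) u rho :
  i \in [:: 0; 1] -> j \in [:: 1; 2] -> tetra u rho ->
  standardizable (u \o tperm i j) (fun k l => rho (tperm i j k) (tperm i j l)) ->
  standardizable u rho.
Proof.
move=> hi hj ut [a [b [a0 ab e fP]]]; exists a, b; split=> //; last first.
  by move: fP; rewrite tetra_set_perm.
apply: perm_trans e; apply: edge_seq_tperm => // k l.
exact: tetra_sym ut.
Qed.

End Tetrahedra.

(** * Moving a vertex to 1 and a triple in sl(2,R) to the standard basis *)

Section NormalForm.
Variables (R : realType) (Lam : int).
Hypothesis hLam : Lam \in [:: -1; 0; 1].
Notation row4R := 'rV[R]_4.
Notation hm := (@hm R Lam).
Notation bform := (@bform R Lam).
Notation e0 := (row4 1 0 0 0 : row4R).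
Notation similarity := (@similarity R Lam).

(* Cayley-Hamilton for [z] acting on the base point [1]. *)
Lemma Tact_hm_e0 (z : row4R) : Tact (hm z) e0 = (2 * c0 z) *: z - bform z z *: e0.
Proof. by rewrite /hm TactE /bform /iform; apply: row4P; rewrite !cE; field. Qed.

Lemma dnorm_hm (z : row4R) : dnorm (hm z) = bform z z ^+ 2.
Proof. by rewrite /dnorm det_hm /gnorm2 /greal gE /=; ring. Qed.

(* With [x] normalized by [det x = 1] and [tr x >= 0], the matrix [1 + x] moves
   the base point to [x], since [(1 + x)^2 = (2 + tr x) x]. *)
Lemma base_orbit (v : row4R) : 0 < bform v v ->
  exists (A : gmat R Lam) a, [/\ 0 < dnorm A, a != 0 & v = a *: Tact A e0].
Proof.
move=> v0; have q0 : 0 < Num.sqrt (bform v v) by rewrite sqrtr_gt0.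
(* The sign of [s] keeps [2 + 2 * p] positive, so that 1 + x is invertible. *)
have [s s0 [sB sc]] : exists2 s : R, s != 0 & s ^+ 2 * bform v v = 1 /\ 0 <= s * c0 v.
  have sB : (Num.sqrt (bform v v))^-1 ^+ 2 * bform v v = 1.
    by rewrite exprVn sqr_sqrtr ?ltW // mulVf // gt_eqF.
  have [c|c] := leP 0 (c0 v).
    exists (Num.sqrt (bform v v))^-1; first by rewrite invr_neq0 // gt_eqF.
    by split=> //; rewrite mulr_ge0 // invr_ge0 ltW.
  exists (- (Num.sqrt (bform v v))^-1); first by rewrite oppr_eq0 invr_neq0 // gt_eqF.
  split; first by rewrite sqrrN.
  by rewrite mulNr -mulrN mulr_ge0 ?invr_ge0 ?ltW // oppr_gt0.
pose w := s *: v; pose p := c0 w.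
have p0 : 0 <= p by rewrite /p /w !cE.
have wB : bform w w = 1 by rewrite /w bformZl bformZr mulrA -expr2.
have zB : bform (e0 + w) (e0 + w) = 2 + 2 * p.
  by rewrite !(bformDl, bformDr) (bformC _ w) !bform_e0 wB cE -/p; ring.
have k0 : 0 < 2 + 2 * p by lra.
have dA : 0 < dnorm (hm (e0 + w)) by rewrite dnorm_hm zB exprn_gt0.
have Te : Tact (hm (e0 + w)) e0 = (2 + 2 * p) *: w.
  rewrite Tact_hm_e0 zB c0D c0_row4 -/p.
  by apply: row4P; rewrite !cE; ring.
exists (hm (e0 + w)), ((2 + 2 * p) * s)^-1; split=> //.
  by rewrite invr_neq0 // mulf_neq0 // gt_eqF.
rewrite Te scalerA /w scalerA -mulrA mulVf ?scale1r //.
by rewrite mulf_neq0 // gt_eqF.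
Qed.

Lemma sim_to_base (v : row4R) : 0 < bform v v -> exists2 T, similarity T & T v = e0.
Proof.
move=> /base_orbit[A [a [dA a0 ->]]]; have dAi := dnorm_ginvmx dA.
exists ( *:%R a^-1 \o Tact (ginvmx A)).
  by apply: sim_comp; [apply: sim_scale; rewrite invr_neq0|exact: sim_act].
by rewrite /= TactZ TactK // scalerA mulVf // scale1r.
Qed.

(** A nonzero nilpotent real matrix has rank one: it is k times the column (x, y) times the row (-y,
    x), and (x, y) spans its kernel. *)
Lemma null_param (q b c : R) : q ^+ 2 + b * c = 0 -> (b != 0) || (c != 0) ->
  exists k x y, [/\ q = - (k * x * y), b = k * x ^+ 2 & c = - (k * y ^+ 2)].
Proof.
move=> e; have [b0|b0 /= c0] := eqVneq b 0.
  move=> /= c0; exists (- c^-1), 0, c; rewrite b0.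
  move: e; rewrite b0 mul0r addr0 => /eqP; rewrite sqrf_eq0 => /eqP ->.
  by split; field.
exists b^-1, b, (- q); split; try by field.
have -> : c = - q ^+ 2 / b by apply: (mulfI b0); rewrite mulrCA mulfV //; lra.
by field.
Qed.

(** For a real matrix [circ A] is the adjugate, so an invertible A acts as [det A] times conjugation
    by A. *)
Lemma Tact_real (a b c d p q x y : R) :
  Tact (mx22 (GCplx Lam a 0) (GCplx Lam b 0) (GCplx Lam c 0) (GCplx Lam d 0))
    (row4 p q x y) =
  row4 ((a * d - b * c) * p)
    ((a * d + b * c) * q - a * c * x + b * d * y)
    (a ^+ 2 * x - b ^+ 2 * y - 2 * a * b * q)
    (d ^+ 2 * y - c ^+ 2 * x + 2 * c * d * q).
Proof. by rewrite TactE; apply: row4P; rewrite !cE; ring. Qed.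

Lemma dnorm_real (a b c d : R) :
  dnorm (mx22 (GCplx Lam a 0) (GCplx Lam b 0) (GCplx Lam c 0) (GCplx Lam d 0)) =
  (a * d - b * c) ^+ 2.
Proof. by rewrite /dnorm mx22_det /gnorm2 /=; ring. Qed.

(* [H, E, F] are the images of the standard basis of sl(2,R) under a linear
   isometry, which is conjugation by a real matrix up to sign. *)
Lemma sim_sl2_triple (H E F : row4R) : c0 H = 0 -> c0 E = 0 -> c0 F = 0 ->
  iform H H = 1 -> iform E E = 0 -> iform F F = 0 ->
  iform H E = 0 -> iform H F = 0 -> iform E F = 1 / 2 ->
  exists T, [/\ similarity T, T e0 = e0, T H = row4 0 1 0 0,
    T E = row4 0 0 1 0 & T F = row4 0 0 0 1].
Proof.
move=> H0 E0 F0 HH EE FF HE HF EF.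
have [||k [x [y [Eq Eb Ec]]]] := @null_param (c1 E) (c2 E) (c3 E).
- by move: EE; rewrite /iform; lra.
- apply: contraT; rewrite negb_or !negbK => /andP[/eqP Eb /eqP Ec].
  have : c1 E ^+ 2 = 0 by move: EE; rewrite /iform Eb Ec; lra.
  move=> /eqP; rewrite sqrf_eq0 => /eqP Eq.
  by move: EF; rewrite /iform Eq Eb Ec; lra.
(* The vector (x, y) is killed by E, and (z, w) is its image under F. In the basis formed by the
   two, E and F take their standard shape; [A] is the adjugate of the matrix with these columns. *)
pose z := c1 F * x + c2 F * y; pose w := c3 F * x - c1 F * y.
pose D := x * w - y * z.
have kD : k * D = 1.
  by move: EF; rewrite /iform Eq Eb Ec /D /z /w; lra.
have D0 : D != 0 by apply: contraTneq isT => D0; move: kD; rewrite D0 mulr0; lra.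
have k0 : k = D^-1 by apply: (mulIf D0); rewrite kD mulVf.
pose A := mx22 (GCplx Lam w 0) (GCplx Lam (- z) 0) (GCplx Lam (- y) 0) (GCplx Lam x 0).
have dA : 0 < dnorm A.
  rewrite dnorm_real (_ : _ - _ = D) ?exprn_even_gt0 //.
  by rewrite /D; ring.
have Te : Tact A e0 = D *: e0.
  by rewrite Tact_real; apply: row4P; rewrite !cE /D; ring.
have TE : Tact A E = D *: row4 0 0 1 0.
  rewrite (row4_eta E) E0 Eq Eb Ec Tact_real; apply: row4P; rewrite !cE.
  - by ring.
  - by ring.
  - transitivity (k * D * D); last by rewrite kD mul1r mulr1.
    by rewrite /D; ring.
  - by ring.
have TF : Tact A F = D *: row4 0 0 0 1.
  have f2 : c2 F * c3 F = - c1 F ^+ 2 by move: FF; rewrite /iform; lra.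
  rewrite (row4_eta F) F0 Tact_real; apply: row4P; rewrite !cE.
  - by ring.
  - by rewrite /w /z; ring.
  - transitivity ((c1 F ^+ 2 + c2 F * c3 F) * D); first by rewrite /D /w /z; ring.
    by rewrite f2 subrr mul0r mulr0.
  - by rewrite /D /w /z; ring.
have I4 u v : c0 u = 0 -> c0 v = 0 -> iform (Tact A u) (Tact A v) = D ^+ 2 * iform u v.
  move=> u0 v0; rewrite (row4_eta u) (row4_eta v) u0 v0 !Tact_real /iform !cE /D.
  by field.
have TH0 : c0 (Tact A H) = 0.
  by rewrite (row4_eta H) Tact_real !cE H0 mulr0.
have TH3 : c3 (Tact A H) = 0.
  apply: (mulfI D0); rewrite mulr0; move: (I4 _ _ H0 E0).
  by rewrite HE TE iformZr /iform !cE; lra.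
have TH2 : c2 (Tact A H) = 0.
  apply: (mulfI D0); rewrite mulr0; move: (I4 _ _ H0 F0).
  by rewrite HF TF iformZr /iform !cE; lra.
have TH1 : c1 (Tact A H) ^+ 2 = D ^+ 2.
  by have := I4 _ _ H0 H0; rewrite HH /iform TH2 TH3; lra.
have sA := sim_act dA.
have TH : Tact A H = row4 0 (c1 (Tact A H)) 0 0.
  by rewrite [LHS]row4_eta TH0 TH2 TH3.
move/eqP: TH1; rewrite eqf_sqr => /orP[] /eqP TH1.
  exists ( *:%R D^-1 \o Tact A); split.
  - by apply: sim_comp => //; apply: sim_scale; rewrite invr_neq0.
  - by rewrite /= Te scalerA mulVf // scale1r.
  - by rewrite /= TH TH1; apply: row4P; rewrite !cE ?mulr0 // mulVf.
  - by rewrite /= TE scalerA mulVf // scale1r.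
  - by rewrite /= TF scalerA mulVf // scale1r.
(* H has gone to minus its target. Entrywise conjugation followed by diag(1, -1) changes, up to a
   global sign, only the coordinate along H; this reverses the orientation of sl(2,R), which real
   conjugations preserve. *)
pose B : gmat R Lam := mx22 (GCplx Lam 1 0) (GCplx Lam 0 0) (GCplx Lam 0 0) (GCplx Lam (-1) 0).
have BE (p q b c : R) : Tact B (cconj (row4 p q b c)) = - row4 p (- q) b c.
  by rewrite /cconj Tact_real; apply: row4P; rewrite !cE; ring.
exists ( *:%R (- D^-1) \o (Tact B \o (@cconj R \o Tact A))); split.
- apply: sim_comp; first by apply: sim_scale; rewrite oppr_eq0 invr_neq0.
  apply: sim_comp; last by apply: sim_comp => //; exact: sim_conj.
  apply: sim_act; rewrite dnorm_real.
  by rewrite (_ : _ ^+ 2 = 1) ?ltr01 //; ring.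
- rewrite /= Te cconjZ TactZ BE; apply: row4P; rewrite !cE; field; exact: D0.
- by rewrite /= TH TH1 BE; apply: row4P; rewrite !cE; field; exact: D0.
- by rewrite /= TE cconjZ TactZ BE; apply: row4P; rewrite !cE; field; exact: D0.
- by rewrite /= TF cconjZ TactZ BE; apply: row4P; rewrite !cE; field; exact: D0.
Qed.

End NormalForm.

(** * Inner products of the edge directions at the base vertex *)

Section Classification.
Variables (R : realType) (Lam : int).
Hypothesis hLam : Lam \in [:: -1; 0; 1].
Notation row4R := 'rV[R]_4.
Notation bform := (@bform R Lam).
Notation kform := (@kform R Lam).
Notation dualq := (@dualq R Lam).
Notation e0 := (row4 1 0 0 0 : row4R).
Notation gcos := (@gcos R Lam).
Notation gsin := (@gsin R Lam).
Notation tetra := (@tetra R Lam).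
Notation standardizable := (@standardizable R Lam).
Implicit Types (u : 'I_4 -> row4R) (rho : 'I_4 -> 'I_4 -> R).

(** All vectors have determinant 1, so real parts and norms of imaginary parts are the cosines and
    squared sines of the lengths at the base vertex. *)
Record normal_tetra u rho : Prop := NormalTetra {
  normal_tetraP : tetra u rho;
  normal_base : u 3 = e0;
  normal_cos : forall i, i != 3 -> c0 (u i) = gcos (rho i 3);
  normal_sin : forall i, i != 3 -> iform (u i) (u i) = gsin (rho i 3) ^+ 2
}.

Lemma standardizable_normal u rho : tetra u rho ->
  (forall v, normal_tetra v rho -> standardizable v rho) -> standardizable u rho.
Proof.
move=> ut H; have [T sT Te] := sim_to_base (tetra_pos 3 ut).
apply: (standardizable_sim sT); have := tetra_sim sT ut.
set v := T \o u => vt; have v3 : v 3 = e0 by [].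
have [m [m0 mB]] : exists m : 'I_4 -> R, (forall i, 0 < m i) /\
    forall i, m i ^+ 2 * bform (v i) (v i) = 1.
  exists (fun i => (Num.sqrt (bform (v i) (v i)))^-1); split=> i.
    by rewrite invr_gt0 sqrtr_gt0 (tetra_pos i vt).
  by rewrite exprVn sqr_sqrtr ?mulVf ?gt_eqF // ?ltW // (tetra_pos i vt).
have mk i k : 0 < k -> k ^+ 2 = bform (v i) (v i) -> m i * k = 1.
  move=> k0 ke; apply/eqP; rewrite -(eqrXn2 (n := 2)) ?ler01 //.
    by rewrite exprMn ke mB expr1n.
  by rewrite mulr_ge0 // ltW.
have Bv i : bform (v i) (v i) * bform e0 e0 = bform (v i) (v i) by rewrite bform_e0 cE mulr1.
have nt : normal_tetra (fun i => m i *: v i) rho.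
  split.
  - exact: tetra_scale.
  - have := mk 3 1 ltr01; rewrite v3 bform_e0 cE expr1n mulr1 => -> //.
    by rewrite scale1r.
  - move=> i i3; have [_ _ [k k0 [e1 e2 _]]] := tetra_edge vt i3.
    rewrite v3 Bv in e1; rewrite v3 bformC bform_e0 in e2.
    by rewrite cE e2 mulrCA (mk i k) // mulr1.
  - move=> i i3; have [_ _ [k k0 [e1 _ e3]]] := tetra_edge vt i3.
    rewrite v3 Bv in e1; rewrite v3 in e3.
    have K0 w : kform w e0 = iform w w by rewrite /kform /iform !cE; field.
    rewrite iformZl iformZr -K0 e3 mulrA -expr2 mulrCA -exprMn (mk i k) //.
    by rewrite expr1n mulr1.
have [a [b [a0 ab e fP]]] := H _ nt; exists a, b; split=> //.
by move: fP; rewrite tetra_set_scale.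
Qed.

Lemma normal_tperm (i j : 'I_4) u rho : i != 3 -> j != 3 -> normal_tetra u rho ->
  normal_tetra (u \o tperm i j) (fun k l => rho (tperm i j k) (tperm i j l)).
Proof.
move=> i3 j3 [ut u3 uc us].
have t3 : tperm i j 3 = 3 by rewrite tpermD.
have tn k : k != 3 -> tperm i j k != 3 by rewrite -{2}t3 (inj_eq perm_inj).
split; first exact: tetra_perm.
- by rewrite /= t3.
- by move=> k /tn k3; rewrite t3 /= uc.
- by move=> k /tn k3; rewrite t3 /= us.
Qed.

(** The kernel of a null covector is tangent to the light cone, so [iform] restricted to it has rank
    at most one and all its Gram determinants vanish. If [c2 n] is nonzero, n is proportional to (0,
    2t, 1, -t^2). *)
Lemma iform_degenerate n (u v : row4R) : n != 0 -> c0 n = 0 -> dualq n = 0 ->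
  pr n u = 0 -> pr n v = 0 -> iform u v ^+ 2 = iform u u * iform v v.
Proof.
move=> n0 n00; rewrite /dualq /pr /iform n00 expr0n mulr0 add0r !mul0r !add0r.
move=> nQ nu nv; have [m0|m0] := eqVneq (c2 n) 0.
  have n1 : c1 n = 0.
    by apply/eqP; rewrite -sqrf_eq0; apply/eqP; rewrite m0 in nQ; lra.
  have n3 : c3 n != 0.
    by apply: contra_neq n0 => n3; apply: row4P; rewrite !cE.
  have u3 : c3 u = 0.
    by apply: (mulfI n3); rewrite n1 m0 in nu; lra.
  have v3 : c3 v = 0.
    by apply: (mulfI n3); rewrite n1 m0 in nv; lra.
  by rewrite u3 v3; field.
pose t := c1 n / (2 * c2 n).
have tn : c1 n = 2 * t * c2 n by rewrite /t; field.
have n3 : c3 n = - (t ^+ 2 * c2 n).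
  by apply: (mulfI (_ : 4 * c2 n != 0)); rewrite ?mulf_neq0 //; rewrite tn in nQ; lra.
have u2 : c2 u = t ^+ 2 * c3 u - 2 * t * c1 u.
  by apply: (mulfI m0); rewrite tn n3 in nu; lra.
have v2 : c2 v = t ^+ 2 * c3 v - 2 * t * c1 v.
  by apply: (mulfI m0); rewrite tn n3 in nv; lra.
by rewrite u2 v2; field.
Qed.

Lemma pr_e0 (n : row4R) : pr n e0 = c0 n.
Proof. by rewrite /pr !cE; ring. Qed.

Lemma normal_sin_gt0 u rho i : normal_tetra u rho -> i != 3 -> 0 < gsin (rho i 3).
Proof.
by move=> [ut _ _ _] i3; have [r0 rpi _] := tetra_edge ut i3; exact: gsin_gt0.
Qed.

(** The face opposite to k contains the base vertex 1, hence its covector has no real component and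
    [iform_degenerate] applies to the other two vertices. *)
Lemma normal_iform u rho (i j k : 'I_4) : normal_tetra u rho ->
  i != 3 -> j != 3 -> k != 3 -> i != k -> j != k ->
  exists2 e : R, e = 1 \/ e = -1 & iform (u i) (u j) = e * (gsin (rho i 3) * gsin (rho j 3)).
Proof.
move=> nt i3 j3 k3 ik jk; have [ut u3 _ us] := nt.
have [n [n0 nQ nu]] := tetra_face ut k.
have n00 : c0 n = 0 by rewrite -pr_e0 -u3 nu // eq_sym.
have := iform_degenerate n0 n00 nQ (nu i ik) (nu j jk).
rewrite !us // -exprMn => /eqP; rewrite eqf_sqr => /orP[] /eqP ->.
  by exists 1; [left|rewrite mul1r].
by exists (-1); [right|rewrite mulN1r].
Qed.

(* With an even number of negative signs, [N] would be orthogonal to all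
   vertices. *)
Lemma normal_sign u rho (e f g : R) : normal_tetra u rho ->
  e = 1 \/ e = -1 -> f = 1 \/ f = -1 -> g = 1 \/ g = -1 ->
  iform (u 0) (u 1) = e * (gsin (rho 0 3) * gsin (rho 1 3)) ->
  iform (u 0) (u 2) = f * (gsin (rho 0 3) * gsin (rho 2 3)) ->
  iform (u 1) (u 2) = g * (gsin (rho 1 3) * gsin (rho 2 3)) ->
  e * f * g = -1.
Proof.
move=> nt he hf hg I01 I02 I12.
have [ut u3 _ us] := nt.
have [//|efg] := eqVneq (e * f * g) (-1).
have efg1 : f = e * g.
  by move: efg; case: he => ->; case: hf => ->; case: hg => ->;
     rewrite ?(mulr1, mul1r, mulrN1, mulN1r, opprK) ?eqxx.
have ee : e * e = 1 by case: he => ->; ring.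
set s0 := gsin (rho 0 3) in I01 I02; set s1 := gsin (rho 1 3) in I01 I12.
set s2 := gsin (rho 2 3) in I02 I12.
have s00 : 0 < s0 by apply: normal_sin_gt0 nt _.
have s10 : 0 < s1 by apply: normal_sin_gt0 nt _.
pose N := s1 *: u 0 - (e * s0) *: u 1.
have IN v : iform N v = s1 * iform (u 0) v - e * s0 * iform (u 1) v.
  by rewrite /N /iform !cE; field.
(* The imaginary part of [N], turned into a covector that annihilates every vertex. *)
have prN v : pr (row4 0 (c1 N) (c3 N / 2) (c2 N / 2)) v = iform N v.
  by rewrite /pr /iform !cE; field.
have N0 : row4 0 (c1 N) (c3 N / 2) (c2 N / 2) = 0 :> row4R.
  apply: (tetra_span ut) => i; rewrite prN IN.
  case: i => [[|[|[|[|//]]]] hi].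
  - rewrite [Ordinal hi](_ : _ = 0); last exact: val_inj.
    rewrite (iformC (u 1)) I01 us // -/s0.
    by transitivity (s1 * s0 ^+ 2 * (1 - e * e)); [ring|rewrite ee; ring].
  - rewrite [Ordinal hi](_ : _ = 1); last exact: val_inj.
    by rewrite I01 us // -/s1; ring.
  - rewrite [Ordinal hi](_ : _ = 2); last exact: val_inj.
    by rewrite I02 I12 efg1; ring.
  - rewrite [Ordinal hi](_ : _ = 3); last exact: val_inj.
    by rewrite u3 /iform !cE; ring.
have [N1 N2 N3] : [/\ c1 N = 0, c2 N = 0 & c3 N = 0].
  split.
  - by have := congr1 (@c1 R) N0; rewrite !cE.
  - by have := congr1 (@c3 R) N0; rewrite !cE; lra.
  - by have := congr1 (@c2 R) N0; rewrite !cE; lra.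
(* Having no imaginary part, [N] is a multiple of the base vertex, which is a linear dependence
   among the vertices. *)
have Nc : N = c0 N *: e0.
  by apply: row4P; rewrite ?N1 ?N2 ?N3 !cE ?mulr0 ?mulr1.
pose a : 'I_4 -> R := fun i => nth 0 [:: s1; - (e * s0); 0; - c0 N] i.
have sa : \sum_i a i *: u i = 0.
  rewrite !big_ord_recl big_ord0 /a /= scale0r add0r addr0.
  rewrite (_ : lift _ (lift _ (lift _ _)) = 3); last exact: val_inj.
  rewrite (_ : lift ord0 ord0 = 1); last exact: val_inj.
  rewrite (_ : ord0 = 0); last exact: val_inj.
  by rewrite u3 scaleNr addrA -/N {1}Nc scaleNr subrr.
have := tetra_indep ut sa 0; rewrite /a /= => s1z.
by move: s10; rewrite s1z ltxx.
Qed.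

End Classification.

(** * Relations between lengths *)

Section Core.
Variables (R : realType) (Lam : int).
Hypothesis hLam : Lam \in [:: -1; 0; 1].
Notation L := (Lam%:~R : R).
Notation row4R := 'rV[R]_4.
Notation bform := (@bform R Lam).
Notation kform := (@kform R Lam).
Notation dualq := (@dualq R Lam).
Notation e0 := (row4 1 0 0 0 : row4R).
Notation gcos := (@gcos R Lam).
Notation gsin := (@gsin R Lam).
Notation edge_rel := (@edge_rel R Lam).
Notation std_rows := (@std_rows R Lam).
Implicit Types (u : 'I_4 -> row4R) (rho : 'I_4 -> 'I_4 -> R).

(** The three incidences determine [n] up to its first component, and nullity becomes the vanishing
    of s(r2 - r0 - r1). The letters stand for cosines and sines but are left free, so that [S2] may
    carry a sign. *)
Lemma face_relation n (C0 C1 C2 S0 S1 S2 : R) : n != 0 -> dualq n = 0 ->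
  S0 != 0 -> S1 != 0 -> S2 != 0 ->
  pr n (row4 C0 S0 (- (2 * S0)) 0) = 0 -> pr n (row4 C1 S1 0 (2 * S1)) = 0 ->
  pr n (row4 C2 S2 0 0) = 0 ->
  S2 * (C0 * C1 - L * (S0 * S1)) = C2 * (S0 * C1 + C0 * S1).
Proof.
move=> n0 nQ S00 S10 S20; rewrite /pr !cE => e1 e2 e3.
have n1 : c1 n = - (C2 / S2) * c0 n.
  by apply: (mulfI S20); rewrite mulrA mulrN mulrCA mulfV //; lra.
have n2 : c2 n = (c1 n + C0 / S0 * c0 n) / 2.
  by apply: (mulfI S00); rewrite mulrA mulrDr mulrA mulrCA mulfV //; lra.
have n3 : c3 n = - (c1 n + C1 / S1 * c0 n) / 2.
  by apply: (mulfI S10); rewrite mulrA mulrN mulrDr mulrA mulrCA mulfV //; lra.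
have n00 : c0 n != 0.
  apply: contra_neq n0 => z; apply: row4P; rewrite cE //.
  - by rewrite n1 z mulr0.
  - by rewrite n2 n1 z; ring.
  - by rewrite n3 n1 z; ring.
apply: (mulfI (expf_neq0 2 n00)).
apply/eqP; rewrite -subr_eq0; apply/eqP.
transitivity (- (S0 * S1 * S2) * dualq n); last by rewrite nQ mulr0.
by rewrite /dualq n2 n3 n1; field; rewrite S00 S10 S20.
Qed.

(** Because the Gram determinant of the imaginary parts vanishes, both forms have the values they
    would have for two points of one geodesic through 1, at parameters r and [e * s]. The difference
    of these is the length. *)
Lemma edge_rel_pair (u v : row4R) r s e : e = 1 \/ e = -1 ->
  0 < r - e * s -> (Lam = 1 -> r - e * s < pi) ->
  c0 u = gcos r -> c0 v = gcos s ->
  iform u u = gsin r ^+ 2 -> iform v v = gsin s ^+ 2 -> iform u v = e * (gsin r * gsin s) ->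
  edge_rel u v (r - e * s).
Proof.
move=> he d0 dpi uc vc us vs uv; split=> //; exists 1; first exact: ltr01.
have r1 := gcos2Dsin2 hLam r; have s1 := gcos2Dsin2 hLam s.
have Cd : gcos (r - e * s) = gcos r * gcos s + L * (e * (gsin r * gsin s)).
  case: he => ->; first by rewrite mul1r gcosB //; ring.
  by rewrite mulN1r opprK gcosD //; ring.
have Sd : gsin (r - e * s) = gsin r * gcos s - e * (gcos r * gsin s).
  case: he => ->; first by rewrite mul1r gsinB //; ring.
  by rewrite mulN1r opprK gsinD //; ring.
have ee : e ^+ 2 = 1 by case: he => ->; ring.
rewrite /kform /bform uc vc us vs uv Cd Sd -!expr2 r1 s1; split; try ring.
rewrite !exprMn sqrrB !exprMn ee; ring.
Qed.

Lemma std_rows_edges a b : 0 < a -> 0 < b -> (Lam = 1 -> a + b < pi) ->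
  [/\ edge_rel (std_rows a b 0) (std_rows a b 1) (a + b),
      edge_rel (std_rows a b 0) (std_rows a b 2) b,
      edge_rel (std_rows a b 0) (std_rows a b 3) a &
  [/\ edge_rel (std_rows a b 1) (std_rows a b 2) a,
      edge_rel (std_rows a b 1) (std_rows a b 3) b
    & edge_rel (std_rows a b 2) (std_rows a b 3) (a + b)]].
Proof.
move=> a0 b0 abpi; rewrite /std_rows /=.
have g0 : gcos 0 = 1 by exact: gcos0.
have h0 : gsin 0 = 0 by exact: gsin0.
(* The directions of rows 0 and 1 have product -1, those of rows 0, 2 and 1, 2 product 1; [e0] is
   treated as a point at parameter 0. *)
pose p1 := (or_introl erefl : (1 : R) = 1 \/ (1 : R) = -1).
pose m1 := (or_intror erefl : (-1 : R) = 1 \/ (-1 : R) = -1).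
split.
- have := @edge_rel_pair (row4 (gcos a) (gsin a) (- (2 * gsin a)) 0)
    (row4 (gcos b) (gsin b) 0 (2 * gsin b)) a b _ m1.
  rewrite mulN1r opprK /iform !cE; apply=> //; try by field.
  by lra.
- apply: edge_relC; have := @edge_rel_pair (row4 (gcos (a + b)) (gsin (a + b)) 0 0)
    (row4 (gcos a) (gsin a) (- (2 * gsin a)) 0) (a + b) a _ p1.
  rewrite mul1r (addrC a) addrK /iform !cE; apply=> //; try by field.
  by move=> /abpi; lra.
- have := @edge_rel_pair (row4 (gcos a) (gsin a) (- (2 * gsin a)) 0) e0 a 0 _ p1.
  rewrite mul1r subr0 /iform !cE g0 h0; apply=> //; try by field.
  by move=> /abpi; lra.
- split.
  + apply: edge_relC; have := @edge_rel_pair (row4 (gcos (a + b)) (gsin (a + b)) 0 0)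
      (row4 (gcos b) (gsin b) 0 (2 * gsin b)) (a + b) b _ p1.
    rewrite mul1r addrK /iform !cE; apply=> //; try by field.
    by move=> /abpi; lra.
  + have := @edge_rel_pair (row4 (gcos b) (gsin b) 0 (2 * gsin b)) e0 b 0 _ p1.
    rewrite mul1r subr0 /iform !cE g0 h0; apply=> //; try by field.
    by move=> /abpi; lra.
  + have := @edge_rel_pair (row4 (gcos (a + b)) (gsin (a + b)) 0 0) e0 (a + b) 0 _ p1.
    rewrite mul1r subr0 /iform !cE g0 h0; apply=> //; try by field.
    by lra.
Qed.

Lemma gsin_eq0 t : gsin t = 0 -> (Lam = 1 -> `|t| < pi) -> t = 0.
Proof.
move=> t0 tpi; have [tn|tp|//] := ltgtP t 0.
- have : 0 < gsin (- t).
    apply: gsin_gt0 => //; first by lra.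
    by move=> /tpi; rewrite ltr0_norm.
  by rewrite gsinN // t0 oppr0 ltxx.
- have : 0 < gsin t.
    by apply: gsin_gt0 => // /tpi; rewrite gtr0_norm.
  by rewrite t0 ltxx.
Qed.

Lemma sin_triangle (r0 r1 r2 : R) : r0 + r1 + r2 = pi ->
  sin r2 = sin r0 * cos r1 + cos r0 * sin r1 /\
  cos r2 = - (cos r0 * cos r1 - sin r0 * sin r1).
Proof.
move=> e; rewrite -sinD -cosD (_ : r2 = pi - (r0 + r1)); last by lra.
by rewrite sinB cosB sinpi cospi; split; ring.
Qed.

End Core.

(** * Reduction to a standard tetrahedron *)

Section Standardization.
Variables (R : realType) (Lam : int).
Hypothesis hLam : Lam \in [:: -1; 0; 1].
Notation L := (Lam%:~R : R).
Notation row4R := 'rV[R]_4.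
Notation bform := (@bform R Lam).
Notation e0 := (row4 1 0 0 0 : row4R).
Notation gcos := (@gcos R Lam).
Notation gsin := (@gsin R Lam).
Notation edge_rel := (@edge_rel R Lam).
Notation tetra := (@tetra R Lam).
Notation normal_tetra := (@normal_tetra R Lam).
Notation standardizable := (@standardizable R Lam).
Notation std_rows := (@std_rows R Lam).
Implicit Types (u : 'I_4 -> row4R) (rho : 'I_4 -> 'I_4 -> R).

Lemma sum_row4 (a0 a1 a2 a3 : R) u :
  \sum_i (nth 0 [:: a0; a1; a2; a3] (i : 'I_4)) *: u i =
  a0 *: u 0 + a1 *: u 1 + a2 *: u 2 + a3 *: u 3.
Proof.
rewrite !big_ord_recl big_ord0 /= addr0 !addrA.
by congr (_ *: u _ + _ *: u _ + _ *: u _ + _ *: u _); apply: val_inj.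
Qed.

Lemma tetra_cone4 (a0 a1 a2 a3 : R) u rho : tetra u rho ->
  0 < a0 -> 0 <= a1 -> 0 <= a2 -> 0 <= a3 ->
  bform (a0 *: u 0 + a1 *: u 1 + a2 *: u 2 + a3 *: u 3)
     (a0 *: u 0 + a1 *: u 1 + a2 *: u 2 + a3 *: u 3) != 0.
Proof.
move=> ut p0 p1 p2 p3; pose a (i : 'I_4) := nth 0 [:: a0; a1; a2; a3] i.
have a0' i : 0 <= a i.
  by rewrite /a; case: i => [[|[|[|[|//]]]] hi] //=; exact: ltW.
have := tetra_cone ut a0'; rewrite sum_row4 => H; rewrite gt_eqF // H //.
by apply/(sum_neq0_ge0 a0'); exists 0; rewrite /a /= gt_eqF.
Qed.

(** With [h = -1] the vertex 2 points the opposite way. The face relation then leaves only lengths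
    with sum pi for Lam = 1, and convexity excludes these. *)
Lemma standardizable_core u rho (h : R) : normal_tetra u rho ->
  h = 1 \/ h = -1 ->
  iform (u 0) (u 1) = - (gsin (rho 0 3) * gsin (rho 1 3)) ->
  iform (u 0) (u 2) = h * (gsin (rho 0 3) * gsin (rho 2 3)) ->
  iform (u 1) (u 2) = h * (gsin (rho 1 3) * gsin (rho 2 3)) ->
  rho 0 3 <= rho 1 3 -> standardizable u rho.
Proof.
move=> nt hh I01 I02 I12 le01; have [ut u3 uc us] := nt.
have i03 : (0 : 'I_4) != 3 by [].
have i13 : (1 : 'I_4) != 3 by [].
have i23 : (2 : 'I_4) != 3 by [].
have := (normal_sin_gt0 hLam nt i03, normal_sin_gt0 hLam nt i13, normal_sin_gt0 hLam nt i23).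
have := (us _ i03, us _ i13, us _ i23); have := (uc _ i03, uc _ i13, uc _ i23).
have [r00 r0pi _] := tetra_edge ut i03.
have [r10 r1pi _] := tetra_edge ut i13.
have [r20 r2pi _] := tetra_edge ut i23.
move: I01 I02 I12 le01 r00 r0pi r10 r1pi r20 r2pi.
move e0r : (rho 0 3) => r0; move e1r : (rho 1 3) => r1; move e2r : (rho 2 3) => r2.
move=> I01 I02 I12 le01 r00 r0pi r10 r1pi r20 r2pi [[C0 C1] C2] [[U0 U1] U2] [[s0 s1] s2].
have hk : h * h = 1 by case: hh => ->; ring.
have sn0 : gsin r0 != 0 by rewrite gt_eqF.
have sn1 : gsin r1 != 0 by rewrite gt_eqF.
have sn2 : gsin r2 != 0 by rewrite gt_eqF.
pose im (w : row4R) := w - c0 w *: e0.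
have imE w w' : iform (im w) (im w') = iform w w' by rewrite /im /iform !cE; field.
have im0 w : c0 (im w) = 0 by rewrite /im !cE; ring.
(* The factor [h] gives [H] inner product 1 with both [M0] and [M1]. *)
have [H defH] : {H | H = (h / gsin r2) *: im (u 2)} by eexists.
have [M0 defM0] : {M | M = (gsin r0)^-1 *: im (u 0)} by eexists.
have [M1 defM1] : {M | M = (gsin r1)^-1 *: im (u 1)} by eexists.
have HH : iform H H = 1.
  rewrite defH iformZl iformZr imE U2; transitivity (h * h); last by [].
  by field.
have M00 : iform M0 M0 = 1 by rewrite defM0 iformZl iformZr imE U0; field.
have M11 : iform M1 M1 = 1 by rewrite defM1 iformZl iformZr imE U1; field.
have M01 : iform M0 M1 = -1 by rewrite defM0 defM1 iformZl iformZr imE I01; field; rewrite sn0 sn1.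
have M0H : iform M0 H = 1.
  rewrite defM0 defH iformZl iformZr imE I02; transitivity (h * h); last by [].
  by field; rewrite sn0 sn2.
have M1H : iform M1 H = 1.
  rewrite defM1 defH iformZl iformZr imE I12; transitivity (h * h); last by [].
  by field; rewrite sn1 sn2.
(* Unit vectors with inner product 1 differ by a null vector orthogonal to both. With [M01] = -1
   this gives [H], [E], [F] the Gram matrix of the standard basis. *)
pose E := 2^-1 *: (H - M0); pose F := 2^-1 *: (M1 - H).
have iformBl a b d : iform (a - b) d = iform a d - iform b d by rewrite /iform !cE; field.
have iformBr a b d : iform d (a - b) = iform d a - iform d b by rewrite /iform !cE; field.
have H0 : c0 H = 0 by rewrite defH cE im0 mulr0.
have M0z : c0 M0 = 0 by rewrite defM0 cE im0 mulr0.
have M1z : c0 M1 = 0 by rewrite defM1 cE im0 mulr0.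
have [] := @sim_sl2_triple R Lam H E F.
- by [].
- by rewrite /E !cE H0 M0z; ring.
- by rewrite /F !cE H0 M1z; ring.
- by [].
- by rewrite /E !(iformZl, iformZr, iformBl, iformBr) (iformC H M0) HH M00 M0H; ring.
- by rewrite /F !(iformZl, iformZr, iformBl, iformBr) (iformC H M1) HH M11 M1H; ring.
- by rewrite /E !(iformZl, iformZr, iformBl, iformBr) (iformC H M0) HH M0H; ring.
- by rewrite /F !(iformZl, iformZr, iformBl, iformBr) (iformC H M1) HH M1H; ring.
- by rewrite /E /F !(iformZl, iformZr, iformBl, iformBr) (iformC H M1) HH M1H M01 M0H; field.
move=> T [sT Te TH TE TF].
have imu w : w = c0 w *: e0 + im w by rewrite /im addrC subrK.
have v0 : T (u 0) = row4 (gcos r0) (gsin r0) (- (2 * gsin r0)) 0.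
  have -> : u 0 = gcos r0 *: e0 + gsin r0 *: (H + (-2) *: E).
    rewrite [LHS]imu C0; congr (_ + _).
    have -> : H + (-2) *: E = M0 by apply: row4P; rewrite /E !cE; field.
    by rewrite defM0 scalerA mulfV // scale1r.
  rewrite (simD sT) !(simZ sT) (simD sT) (simZ sT) Te TH TE.
  by apply: row4P; rewrite !cE; ring.
have v1 : T (u 1) = row4 (gcos r1) (gsin r1) 0 (2 * gsin r1).
  have -> : u 1 = gcos r1 *: e0 + gsin r1 *: (H + 2 *: F).
    rewrite [LHS]imu C1; congr (_ + _).
    have -> : H + 2 *: F = M1 by apply: row4P; rewrite /F !cE; field.
    by rewrite defM1 scalerA mulfV // scale1r.
  rewrite (simD sT) !(simZ sT) (simD sT) (simZ sT) Te TH TF.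
  by apply: row4P; rewrite !cE; ring.
have v2 : T (u 2) = row4 (gcos r2) (h * gsin r2) 0 0.
  have -> : u 2 = gcos r2 *: e0 + (h * gsin r2) *: H.
    rewrite [LHS]imu C2; congr (_ + _); rewrite defH scalerA.
    have -> : h * gsin r2 * (h / gsin r2) = h * h by field.
    by rewrite hk scale1r.
  rewrite (simD sT) !(simZ sT) Te TH.
  by apply: row4P; rewrite !cE; ring.
apply: (standardizable_sim sT); have vt := tetra_sim sT ut.
have v3 : T (u 3) = e0 by rewrite u3.
have h0 : h != 0 by case: hh => ->; rewrite ?oppr_eq0 oner_eq0.
have rel : gsin (h * r2 - (r0 + r1)) = 0.
  have [n [n0 nQ nv]] := tetra_face vt 3.
  have := @face_relation R Lam n (gcos r0) (gcos r1) (gcos r2)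
    (gsin r0) (gsin r1) (h * gsin r2) n0 nQ sn0 sn1 (mulf_neq0 h0 sn2).
  rewrite -v0 -v1 -v2 (nv 0) // (nv 1) // (nv 2) // => /(_ erefl erefl erefl) e.
  have Sh : gsin (h * r2) = h * gsin r2.
    by case: hh => ->; rewrite ?mul1r // !mulN1r gsinN.
  have Ch : gcos (h * r2) = gcos r2.
    by case: hh => ->; rewrite ?mul1r // !mulN1r gcosN.
  by rewrite gsinB // Sh Ch gcosD // gsinD // e; ring.
(* Otherwise s(r1) u_0 + s(r0) u_1 - s(r0 + r1) u_3 belongs to the cone. Its real part vanishes by
   the addition formula and its imaginary part is a multiple of (1, -1, 1), so it is null. *)
have r01 : Lam = 1 -> r0 + r1 < pi.
  move=> e1; rewrite ltNge; apply/negP => pile.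
  have s01 : gsin (r0 + r1) <= 0.
    rewrite /Defs.gsin e1 /=; have := r0pi e1; have := r1pi e1 => ? ?.
    have : 0 <= sin (r0 + r1 - pi) by apply: sin_ge0_pi; apply/andP; split; lra.
    by rewrite sinB cospi sinpi; lra.
  have Lr : L = 1 by rewrite e1.
  have ns01 : 0 <= - gsin (r0 + r1) by rewrite oppr_ge0.
  have := tetra_cone4 vt s1 (ltW s0) (lexx 0) ns01.
  rewrite /= v0 v1 v2 v3 => /eqP; apply.
  by rewrite /bform /iform !cE gsinD // Lr; field.
have h1 : h = 1.
  case: hh => // hN; exfalso.
  have S0 : gsin (r0 + r1 + r2) = 0.
    rewrite -[RHS]oppr0 -[in RHS]rel -gsinN //; congr gsin.
    by rewrite hN; ring.
  have [e1|n1] := eqVneq Lam 1; last first.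
    have : r0 + r1 + r2 = 0.
      by apply: (gsin_eq0 hLam S0) => e1; rewrite e1 eqxx in n1.
    by lra.
  have rsum : r0 + r1 + r2 = pi.
    apply/eqP; rewrite -subr_eq0; apply/eqP/(gsin_eq0 hLam) => [|_].
      have := S0; rewrite /Defs.gsin e1 /= sinB cospi sinpi => ->.
      by ring.
    have := r2pi e1; have := r01 e1; move=> ? ?.
    by rewrite ltr_norml; apply/andP; split; lra.
  have [t1 t2] := sin_triangle rsum.
  have Lr : L = 1 by rewrite e1.
  (* For lengths with sum pi the combination weighted by the sines, s(r0) u_0 + s(r1) u_1 + s(r2)
     u_2, is null; [a1] and [a2] are the identities for the angles of a Euclidean triangle that show
     it. *)
  have := tetra_cone4 vt s0 (ltW s1) (ltW s2) (lexx 0).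
  rewrite /= v0 v1 v2 v3 => /eqP; apply.
  have q0 := cos2Dsin2 r0; have q1 := cos2Dsin2 r1; have q2 := cos2Dsin2 r2.
  rewrite /bform /iform !cE Lr hN /Defs.gsin /Defs.gcos e1 /=.
  have a1 : sin r0 * cos r0 + sin r1 * cos r1 + sin r2 * cos r2 = 2 * sin r0 * sin r1 * sin r2.
    rewrite t1 t2.
    have -> : sin r0 * cos r0 = sin r0 * cos r0 * (cos r1 ^+ 2 + sin r1 ^+ 2) by rewrite q1 mulr1.
    have -> : sin r1 * cos r1 = sin r1 * cos r1 * (cos r0 ^+ 2 + sin r0 ^+ 2) by rewrite q0 mulr1.
    by ring.
  have a2 : sin r0 * sin r0 + sin r1 * sin r1 - sin r2 * sin r2 = 2 * sin r0 * sin r1 * cos r2.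
    rewrite t1 t2.
    have -> : sin r0 * sin r0 = sin r0 * sin r0 * (cos r1 ^+ 2 + sin r1 ^+ 2) by rewrite q1 mulr1.
    have -> : sin r1 * sin r1 = sin r1 * sin r1 * (cos r0 ^+ 2 + sin r0 ^+ 2) by rewrite q0 mulr1.
    by ring.
  transitivity ((sin r0 * cos r0 + sin r1 * cos r1 + sin r2 * cos r2) ^+ 2 +
    (sin r0 * sin r0 + sin r1 * sin r1 - sin r2 * sin r2) ^+ 2 -
    (2 * sin r0 * sin r1) ^+ 2); first by field.
  rewrite a1 a2.
  transitivity ((2 * sin r0 * sin r1) ^+ 2 * (cos r2 ^+ 2 + sin r2 ^+ 2 - 1)); first by ring.
  by rewrite q2 subrr mulr0.
subst h; rewrite mul1r in rel; rewrite mul1r in v2.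
have er2 : r2 = r0 + r1.
  apply/eqP; rewrite -subr_eq0; apply/eqP/(gsin_eq0 hLam) => // e1.
  have := r2pi e1; have := r01 e1; move=> ? ?.
  by rewrite ltr_norml; apply/andP; split; lra.
have vE : T \o u = std_rows r0 r1.
  apply/funext => -[[|[|[|[|//]]]] hi]; rewrite /std_rows /=.
  - by rewrite -v0; congr (T (u _)); apply: val_inj.
  - by rewrite -v1; congr (T (u _)); apply: val_inj.
  - by rewrite -er2 -v2; congr (T (u _)); apply: val_inj.
  - by rewrite -v3; congr (T (u _)); apply: val_inj.
rewrite vE in vt *; exists r0, r1; split=> //; last first.
  exists id; split; [exact: XLam_isometry_id|by exists id|exact: image_id].
have [E01 E02 E03 [E12 E13 E23]] := std_rows_edges hLam r00 r10 r01.
have inj i j r : i != j -> edge_rel (std_rows r0 r1 i) (std_rows r0 r1 j) r -> rho i j = r.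
  move=> ij; apply: (edge_rel_inj hLam) (tetra_edge vt ij).
    exact: tetra_pos vt.
  exact: tetra_pos vt.
rewrite /edge_seq (inj _ _ _ _ E01) // (inj _ _ _ _ E02) // (inj _ _ _ _ E03) //.
rewrite (inj _ _ _ _ E12) // (inj _ _ _ _ E13) // (inj _ _ _ _ E23) //.
by apply/seq.permP => p /=; ring.
Qed.

(** An odd number of the three signs is -1; transpositions move one such sign to the pair 0, 1, and
    the other two then agree. Swapping 0 and 1 afterwards keeps this pattern and orders the
    lengths. *)
Lemma tetra_standardizable u rho : tetra u rho -> standardizable u rho.
Proof.
move=> ut; apply: (standardizable_normal ut) => {ut u} u nt.
have i03 : (0 : 'I_4) != 3 by [].
have i13 : (1 : 'I_4) != 3 by [].
have i23 : (2 : 'I_4) != 3 by [].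
have ordered (v : 'I_4 -> row4R) (r : 'I_4 -> 'I_4 -> R) h : normal_tetra v r -> h = 1 \/ h = -1 ->
    iform (v 0) (v 1) = - (gsin (r 0 3) * gsin (r 1 3)) ->
    iform (v 0) (v 2) = h * (gsin (r 0 3) * gsin (r 2 3)) ->
    iform (v 1) (v 2) = h * (gsin (r 1 3) * gsin (r 2 3)) -> standardizable v r.
  move=> vn hh I01 I02 I12; have [le01|/ltW le10] := leP (r 0 3) (r 1 3).
    exact: standardizable_core I12 le01.
  apply: (@standardizable_tperm _ _ hLam 0 1) => //; first by case: vn.
  have vn' := normal_tperm i03 i13 vn.
  apply: (standardizable_core vn' hh); rewrite /= ?tpermL ?tpermR ?tpermD //.
  by rewrite iformC I01 mulrC.
have negative (v : 'I_4 -> row4R) (r : 'I_4 -> 'I_4 -> R) : normal_tetra v r ->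
    iform (v 0) (v 1) = - (gsin (r 0 3) * gsin (r 1 3)) -> standardizable v r.
  move=> vn I01.
  have [f hf I02] := normal_iform (i := 0) (j := 2) (k := 1) vn i03 i23 i13 isT isT.
  have [g hg I12] := normal_iform (i := 1) (j := 2) (k := 0) vn i13 i23 i03 isT isT.
  have efg : -1 * f * g = -1.
    by apply: (normal_sign hLam vn) => //; [right|rewrite mulN1r].
  have fg : g = f.
    by move: efg; case: hf => ->; case: hg => ->; lra.
  by rewrite fg in I12; exact: ordered I12.
have [e he I01] := normal_iform (i := 0) (j := 1) (k := 2) nt i03 i13 i23 isT isT.
have [f hf I02] := normal_iform (i := 0) (j := 2) (k := 1) nt i03 i23 i13 isT isT.
have [g hg I12] := normal_iform (i := 1) (j := 2) (k := 0) nt i13 i23 i03 isT isT.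
have efg := normal_sign hLam nt he hf hg I01 I02 I12.
have ut : tetra u rho by case: nt.
case: he => [ee|ee]; last by apply: negative => //; rewrite I01 ee mulN1r.
case: hf => [ef|ef]; last first.
  apply: (@standardizable_tperm _ _ hLam 1 2) => //.
  have vn' := normal_tperm i13 i23 nt; apply: (negative _ _ vn').
  by rewrite /= tpermL !tpermD // I02 ef mulN1r.
have eg : g = -1 by move: efg; rewrite ee ef !mul1r.
apply: (@standardizable_tperm _ _ hLam 0 2) => //.
have vn' := normal_tperm i03 i23 nt; apply: (negative _ _ vn').
by rewrite /= tpermL !tpermD // iformC I12 eg mulN1r mulrC.
Qed.

End Standardization.

(** * Existence of edges and conclusion *)

Section MainTheorem.
Variables (R : realType) (Lam : int).
Hypothesis hLam : Lam \in [:: -1; 0; 1].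
Notation L := (Lam%:~R : R).
Notation row4R := 'rV[R]_4.
Notation hm := (@hm R Lam).
Notation kform := (@kform R Lam).
Notation e0 := (row4 1 0 0 0 : row4R).
Notation gcos := (@gcos R Lam).
Notation gsin := (@gsin R Lam).
Notation edge_rel := (@edge_rel R Lam).
Notation tetra := (@tetra R Lam).
Notation tetra_set := (@tetra_set R Lam).
Notation std_rows := (@std_rows R Lam).

Lemma gsin_ge0 (t : R) : 0 <= t -> (Lam = 1 -> t < pi) -> 0 <= gsin t.
Proof.
rewrite le_eqVlt => /orP[/eqP <- _|t0 tpi]; first by rewrite gsin0.
by rewrite ltW // gsin_gt0.
Qed.

(** The geodesic is trigonometric interpolation between the two vectors, with weights [s(r - t)] and
    [q * s(t)]; positivity of [q] keeps it on the edge. *)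
Lemma edge_length_exists (x : 'I_4 -> gmat R Lam) i j r : lin_indep x ->
  (forall z, subcone x [set: 'I_4]%SET z -> represents z) -> i != j ->
  edge_rel (hv (x i)) (hv (x j)) r -> edge_length x i j r.
Proof.
move=> xI xC ij [r0 rpi [m m0 [e1 e2 e3]]].
have indep a b : a *: hv (x i) + b *: hv (x j) = 0 -> a = 0 /\ b = 0.
  exact: vertex_indep2.
have xE k : hm (hv (x k)) = x k by exact: vertexE.
have [A [a [dA a0 ui]]] := base_orbit (vertex_pos xC i).
have uj : hv (x j) = Tact A (Tact (ginvmx A) (hv (x j))) by rewrite TactKV.
set w := Tact (ginvmx A) _ in uj.
have d0 : dnorm A != 0 by rewrite gt_eqF.
(* Chosen so that [w] is k times the point at parameter [r] of a unit-speed geodesic through 1. *)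
pose k := m / (a * dnorm A).
have k0 : k != 0 by rewrite /k mulf_neq0 ?invr_neq0 ?mulf_neq0 // gt_eqF.
have mk : m = a * dnorm A * k by rewrite /k mulrC divfK // mulf_neq0.
have Sr : 0 < gsin r by exact: gsin_gt0.
have Sr0 : gsin r != 0 by rewrite gt_eqF.
have w0 : c0 w = gcos r * k.
  apply: (mulfI (mulf_neq0 a0 d0)).
  have := e2; rewrite ui uj bformZl bform_Tact bform_e0 mk.
  by rewrite mulrA => ->; ring.
have ww : iform w w = gsin r ^+ 2 * k ^+ 2.
  apply: (mulfI (expf_neq0 2 (mulf_neq0 a0 d0))).
  have := e3; rewrite ui uj kformZl kform_Tact mk.
  have -> : kform e0 w = iform w w by rewrite /kform /iform !cE; field.
  by move=> e; rewrite exprMn -mulrA e; ring.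
have [M [M0 MM wM]] : exists M, [/\ c0 M = 0, iform M M = 1 &
    w = k *: (gcos r *: e0 + gsin r *: M)].
  exists ((gsin r * k)^-1 *: (w - c0 w *: e0)); split.
  - by rewrite !cE; ring.
  - have e : iform (w - c0 w *: e0) (w - c0 w *: e0) = iform w w by rewrite /iform !cE; field.
    by rewrite iformZl iformZr e ww; field; rewrite Sr0 k0.
  - by apply: row4P; rewrite !cE ?w0; field; rewrite Sr0 k0.
have vL : L * iform M M = Lam%:~R by rewrite MM mulr1.
have ceq t := geodesicE A t hLam M0 vL.
pose q := a / k.
have q0 : 0 < q.
  have -> : q = a ^+ 2 * dnorm A / m by rewrite /q mk; field; rewrite a0 d0 k0.
  by rewrite divr_gt0 // mulr_gt0 // exprn_even_gt0.
have cq t : geodesic A (hm M) t =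
    pt (hm (gsin (r - t) *: hv (x i) + (q * gsin t) *: hv (x j))).
  rewrite ceq; apply/pt_hmP; exists (gsin r * a); first by rewrite mulf_neq0.
  rewrite uj wM ui TactZ TactD !TactZ gsinB // /q.
  by apply/rowP => l; rewrite !mxE; field.
have rt t : 0 <= t <= r -> 0 <= gsin t /\ 0 <= gsin (r - t).
  by move=> /andP[t0 tr]; split; apply: gsin_ge0 => [|/rpi]; lra.
have sum0 t : 0 <= t <= r -> 0 < gsin (r - t) + q * gsin t.
  move=> tr; have [s0 s1] := rt t tr; have [t0 t1] := andP tr.
  have [->|tn] := eqVneq t 0.
    by rewrite subr0 gsin0 // mulr0 addr0.
  have tp : 0 < t by rewrite lt_neqAle eq_sym tn t0.
  have stp : 0 < gsin t by apply: gsin_gt0 => // /rpi; lra.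
  by rewrite ltr_wpDl // mulr_gt0.
split; first exact: ltW.
exists (geodesic A (hm M)); split.
- exists A, (hm M); split=> //.
  + exact/in_PGLpP.
  + exact: in_xLam_hm.
  + rewrite -(hm0 _ Lam) => /hm_inj z; move: MM; rewrite z /iform !cE => /eqP.
    by rewrite !mul0r addr0 mul0r addr0 eq_sym oner_eq0.
  + by rewrite xform_hm MM normr1.
- rewrite cq subr0 gsin0 // mulr0 scale0r addr0 -{2}(xE i).
  by apply/esym/pt_hmP; exists (gsin r).
- rewrite cq subrr gsin0 // scale0r add0r -{2}(xE j).
  by apply/esym/pt_hmP; exists (q * gsin r); rewrite // mulf_neq0 // gt_eqF.
- split.
  + move=> t /= tr; apply/(edgeP xC _ ij); have [s0 s1] := rt t tr.
    exists (gsin (r - t)), (q * gsin t); split=> //.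
    * by rewrite mulr_ge0 // ltW.
    * by rewrite gt_eqF // sum0.
  + move=> t t'; rewrite !inE /= => tr tr'; rewrite !cq => /pt_hmP[b b0].
    move/eqP; rewrite -subr_eq0 => /eqP e.
    have /indep[f1 f2] : (gsin (r - t') - b * gsin (r - t)) *: hv (x i) +
        (q * gsin t' - b * (q * gsin t)) *: hv (x j) = 0.
      by rewrite -[RHS]e; apply/rowP => l; rewrite !mxE; ring.
    have f3 : gsin t' = b * gsin t.
      by apply: (mulfI (_ : q != 0)); rewrite ?gt_eqF //; lra.
    have f4 : gsin (r - t') = b * gsin (r - t) by lra.
    have : gsin r * gsin (t - t') = 0.
      by rewrite -gsin_interp // f3 f4; ring.
    move=> /eqP; rewrite mulf_eq0 (negPf Sr0) /= => /eqP z.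
    apply/eqP; rewrite -subr_eq0; apply/eqP/(gsin_eq0 hLam z) => /rpi rp.
    by rewrite ltr_norml; apply/andP; split; lra.
  + move=> p /(edgeP xC _ ij)[s [v [s0 v0 sv0 ->]]].
    have sv : 0 < s + v by rewrite lt_neqAle eq_sym sv0 addr_ge0.
    (* A zero of [f] is a parameter where the interpolation weights are proportional to [(s, v)];
       the signs at 0 and r yield one. *)
    pose f t := q * gsin t * s - gsin (r - t) * v.
    have fc : {within `[0, r], continuous f}.
      apply: continuous_subspaceT => t.
      have ct : {for t, continuous gsin} by exact: continuous_gsin.
      have crt : {for t, continuous (fun t => gsin (r - t))}.
        apply: continuous_comp; last exact: continuous_gsin.
        by apply: cvgB; [exact: cvg_cst|exact: cvg_id].
      apply: cvgB; apply: cvgM; try exact: cvg_cst.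
        by apply: cvgM; [exact: cvg_cst|exact: ct].
      exact: crt.
    have f0 : f 0 <= 0.
      by rewrite /f gsin0 // mulr0 mul0r add0r subr0 oppr_le0 mulr_ge0 // ltW.
    have fr : 0 <= f r.
      rewrite /f subrr gsin0 // mul0r subr0 mulr_ge0 // mulr_ge0 // ltW //.
    have [|t tr ft] := @IVT R f 0 r 0 (ltW r0) fc.
      by rewrite ge_min f0 le_max fr orbT.
    exists t; first by move: tr; rewrite in_itv.
    have tr' : 0 <= t <= r by move: tr; rewrite in_itv.
    rewrite cq; apply/esym/pt_hmP.
    exists ((gsin (r - t) + q * gsin t) / (s + v)).
      by rewrite mulf_neq0 ?invr_neq0 // gt_eqF // sum0.
    have g1 : gsin (r - t) = (gsin (r - t) + q * gsin t) / (s + v) * s.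
      by apply: (mulIf sv0); rewrite [RHS]mulrAC divfK //; move: ft; rewrite /f; lra.
    have g2 : q * gsin t = (gsin (r - t) + q * gsin t) / (s + v) * v.
      by apply: (mulIf sv0); rewrite [RHS]mulrAC divfK //; move: ft; rewrite /f; lra.
    by rewrite scalerDr !scalerA -g1 -g2.
Qed.

(** Given lengths are constrained only for [i < j], so they are symmetrized. *)
Lemma lightlike_tetra (x : 'I_4 -> gmat R Lam) r : lightlike_tetrahedron x ->
  edge_lengths x r ->
  tetra (fun i => hv (x i)) (fun i j => if (i < j)%N then r i j else r j i).
Proof.
move=> [xI xC xF _] xr; split.
- exact: vertex_indep.
- move=> a a0 s0; apply/represents_hm; apply: (xC _); exists a.
    by split=> //; rewrite (eq_bigl xpredT) // => i; rewrite inE.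
  rewrite (rscale_vertices xC); congr hm.
  by apply: eq_bigl => i; rewrite inE.
- move=> k; have [P [n [_ n0 nQ _ nu]]] := face_covector hLam xC xF k.
  by exists n.
- move=> i j ij; case: ifP => [/xr|ji]; first exact: (edge_length_rel hLam xI xC xF).
  have ji' : (j < i)%N by rewrite ltn_neqAle leqNgt ji andbT eq_sym.
  apply: edge_relC; apply: (edge_length_rel hLam xI xC xF); first by rewrite eq_sym.
  exact: xr.
Qed.

Lemma tetrahedronE (x : 'I_4 -> gmat R Lam) :
  (forall z, subcone x [set: 'I_4]%SET z -> represents z) ->
  tetrahedron x = tetra_set (fun i => hv (x i)).
Proof.
move=> xC; have sT (V : nmodType) (F : 'I_4 -> V) :
    \sum_(i in [set: 'I_4]%SET) F i = \sum_i F i.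
  by apply: eq_bigl => i; rewrite inE.
apply/seteqP; split=> p.
  move=> [z [a [a0 s0] <-] <-]; exists a; split=> //; first by rewrite -sT.
  by rewrite (rscale_vertices xC) sT.
move=> [a [a0 s0 ->]]; exists (hm (\sum_i a i *: hv (x i))) => //.
exists a; first by rewrite /= sT.
by rewrite (rscale_vertices xC) sT.
Qed.

(** Both lists are sorted, so being permutations of each other they coincide. *)
Lemma std_perm_inj (a b a' b' : R) : 0 < a -> a <= b -> 0 < a' -> a' <= b' ->
  perm_eq [:: a; a; b; b; a + b; a + b] [:: a'; a'; b'; b'; a' + b'; a' + b'] ->
  a = a' /\ b = b'.
Proof.
move=> a0 ab a'0 ab' e.
have sd (c d : R) : 0 < c -> c <= d -> sorted <=%R [:: c; c; d; d; c + d; c + d].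
  by move=> c0 cd /=; rewrite !lexx cd andbT /=; lra.
have := sorted_eq le_trans le_anti (sd _ _ a0 ab) (sd _ _ a'0 ab') e.
by case.
Qed.

Lemma lightlike_isometric (x y : 'I_4 -> gmat R Lam) (r s : 'I_4 -> 'I_4 -> R) :
  lightlike_tetrahedron x -> lightlike_tetrahedron y ->
  edge_lengths x r -> edge_lengths y s -> perm_eq (edge_seq r) (edge_seq s) ->
  exists2 f : gpoint R Lam -> gpoint R Lam,
    XLam_isometry f & f @` tetrahedron x = tetrahedron y.
Proof.
move=> hx hy hr hs rs.
have [a [b [a0 ab ar [f [fi _ fx]]]]] :=
  tetra_standardizable hLam (lightlike_tetra hx hr).
have [a' [b' [a'0 ab' as' [g [gi [h gh hg] gy]]]]] :=
  tetra_standardizable hLam (lightlike_tetra hy hs).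
have [ea eb] : a = a' /\ b = b'.
  apply: std_perm_inj => //; apply: perm_trans as'.
  by apply: perm_trans rs; rewrite perm_sym.
subst a' b'; exists (h \o f).
  by apply: XLam_isometry_comp => //; exact: XLam_isometry_inv gi gh hg.
have [_ xC _ _] := hx; have [_ yC _ _] := hy.
rewrite -image_comp !tetrahedronE // fx -gy image_comp.
rewrite (_ : h \o g = id) ?image_id //.
by apply/funext => p /=; rewrite gh.
Qed.

Lemma hv_std (a b : R) i : hv (std_vertices Lam a b (- (a + b)) i) = std_rows a b i.
Proof.
rewrite /std_vertices /std_rows.
case: i => [[|[|[|[|//]]]] hi] /=; rewrite /hv !mxE /=; apply: row4P;
  rewrite !cE ?opprK /=; ring.
Qed.

Lemma std_edges (a b : R) (r : 'I_4 -> 'I_4 -> R) (l : lightlike_tetrahedron (std_vertices Lam a b (- (a + b)))) :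
  0 < a -> 0 < b -> (Lam = 1 -> a + b < pi) ->
  edge_lengths (std_vertices Lam a b (- (a + b))) r <->
  [/\ r 0 1 = a + b, r 0 2 = b, r 0 3 = a & [/\ r 1 2 = a, r 1 3 = b & r 2 3 = a + b]].
Proof.
move=> a0 b0 abpi; have [xI xC xF _] := l.
have [E01 E02 E03 [E12 E13 E23]] := std_rows_edges hLam a0 b0 abpi.
have len (i j : 'I_4) s : (i < j)%N -> edge_rel (std_rows a b i) (std_rows a b j) s ->
    edge_length (std_vertices Lam a b (- (a + b))) i j s.
  move=> ij; rewrite -!hv_std; apply: edge_length_exists => //.
  by rewrite neq_ltn ij.
have uniq (i j : 'I_4) s : (i < j)%N -> edge_rel (std_rows a b i) (std_rows a b j) s ->
    edge_lengths (std_vertices Lam a b (- (a + b))) r -> r i j = s.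
  move=> ij; rewrite -!hv_std => es /(_ i j ij) rl.
  have ij' : i != j by rewrite neq_ltn ij.
  by apply: (edge_rel_inj hLam) (edge_length_rel hLam xI xC xF ij' rl) es;
     exact: vertex_pos.
split=> [rl|[r01 r02 r03 [r12 r13 r23]]].
  by do !split; apply: uniq.
move=> i j ij.
have ord4 (k : 'I_4) : [\/ k = 0, k = 1, k = 2 | k = 3].
  case: k => [[|[|[|[|//]]]] hk]; [constructor 1|constructor 2|constructor 3|constructor 4];
    exact: val_inj.
case: (ord4 i) (ord4 j) => -> [] -> in ij *; rewrite // ?r01 ?r02 ?r03 ?r12 ?r13 ?r23;
  exact: len.
Qed.

End MainTheorem.

Theorem corollary4p5 (R : realType) (Lam : int)
    (hLam : Lam \in [:: -1; 0; 1]) :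
  (forall (x y : 'I_4 -> gmat R Lam) (r s : 'I_4 -> 'I_4 -> R),
     lightlike_tetrahedron x -> lightlike_tetrahedron y ->
     edge_lengths x r -> edge_lengths y s ->
     perm_eq (edge_seq r) (edge_seq s) ->
     exists2 f : gpoint R Lam -> gpoint R Lam,
       XLam_isometry f & f @` tetrahedron x = tetrahedron y)
  /\
  (forall alpha beta gamma : R,
     0 < alpha -> 0 < beta -> gamma = - (alpha + beta) ->
     (Lam = 1 -> alpha + beta < pi) ->
     lightlike_tetrahedron (std_vertices Lam alpha beta gamma) ->
     (exists r, edge_lengths (std_vertices Lam alpha beta gamma) r)
     /\ forall r, edge_lengths (std_vertices Lam alpha beta gamma) r ->
        [/\ r 0 1 = r 2 3, r 0 2 = r 1 3, r 0 3 = r 1 2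
          & perm_eq [:: r 0 1; r 0 2; r 0 3] [:: alpha; beta; alpha + beta]]).
Proof.
split; first exact: lightlike_isometric.
move=> alpha beta _ a0 b0 -> abpi l; split.
  (* The entries above the diagonal are the lengths; all others, including the missing last row,
     default to 0. *)
  exists (fun i j : 'I_4 => nth 0 (nth [::]
    [:: [:: 0; alpha + beta; beta; alpha]; [:: 0; 0; alpha; beta];
        [:: 0; 0; 0; alpha + beta]] i) j).
  by apply/std_edges.
move=> r /(std_edges hLam r l a0 b0 abpi)[-> -> -> [-> -> ->]]; split=> //.
by apply/seq.permP => p /=; ring.
Qed.
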